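(* For the class of finitely presented, tree-like inverse monoids, the word problem is uniformly solvable. That is, there is an algorithm which takes as input a finite inverse monoid presentation $\mathrm{Inv}\langle A\mid R\rangle$ defining a tree-like inverse monoid $M$, together with two words $u,v\in (A\cup A^{-1})^*$, and decides whether $u$ and $v$ represent the same element of $M$.
   Context: An inverse monoid is a monoid in which every element $s$ has a unique $s^{-1}$ with $ss^{-1}s=s$ and $s^{-1}ss^{-1}=s^{-1}$. Let $A^{-1}$ be a set of formal inverses of $A$, disjoint from $A$, and give $(A\cup A^{-1})^*$ the obvious involution. The inverse monoid $M=\mathrm{Inv}\langle A\mid R\rangle$, $R\subseteq (A\cup A^{-1})^*\times(A\cup A^{-1})^*$, is the quotient of $(A\cup A^{-1})^*$ by the congruence $\tau$ generated by $R$ and all pairs $(uu^{-1}u,u)$, $(uu^{-1}vv^{-1},vv^{-1}uu^{-1})$. The presentation is finite if $A$ and $R$ are finite. The word problem for $M$ is the problem of deciding whether $u\tau=v\tau$ for given words $u,v$. The Cayley graph of $M$ with respect to $A$ has vertex set $M$ and an edge labeled $a$ from $s$ to $sa$ for all $s\in M$, $a\in A\cup A^{-1}$. The Schützenberger graphs of $M$ are its strongly connected components; their edges occur in inverse pairs and they are metric spaces under the path metric on vertices. A finitely generated inverse monoid is tree-like if each of its Schützenberger graphs (with respect to some, equivalently any, finite generating set) is quasi-isometric to a tree. *)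

(* Defs.v *)
From HB Require Import structures.
From Stdlib Require Rdefinitions.
From mathcomp Require Import all_boot all_order all_algebra generic_quotient.
From mathcomp Require Import boolp Rstruct.

Set Implicit Arguments.
Unset Strict Implicit.
Unset Printing Implicit Defensive.

Import Order.TTheory GRing.Theory Num.Theory.

(* Kleene's partial recursive functions, as finite syntax trees indexed by     *)
(* their arity; [computes f v y] means that f is defined at v with value y.    *)

Inductive recfun : nat -> Type :=
| RZero : recfun 0
| RSucc : recfun 1
| RProj k of 'I_k : recfun k
| RComp m k of recfun m & ('I_m -> recfun k) : recfun k
| RPrim k of recfun k & recfun k.+2 : recfun k.+1
| RMin k of recfun k.+1 : recfun k.

(* In the [RPrim] case, s is the course of values: s 0 = f v, and              *)
(* s (i+1) = g (i, s i, v) for i below the recursion argument.                 *)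
Fixpoint computes k (f : recfun k) : k.-tuple nat -> nat -> Prop :=
  match f in recfun k return k.-tuple nat -> nat -> Prop with
  | RZero => fun _ y => y = 0
  | RSucc => fun v y => y = (tnth v ord0).+1
  | RProj _ i => fun v y => y = tnth v i
  | RComp m _ f g => fun v y =>
      exists w : m.-tuple nat,
        (forall i, computes (g i) v (tnth w i)) /\ computes f w y
  | RPrim _ f g => fun v y =>
      exists s : nat -> nat,
        [/\ computes f [tuple of behead v] (s 0),
            forall i, i < thead v ->
              computes g [tuple of i :: s i :: behead v] (s i.+1)
          & y = s (thead v)]
  | RMin _ f => fun v y =>
      computes f [tuple of y :: v] 0 /\
      (forall z, z < y -> exists c, computes f [tuple of z :: v] c.+1)
  end.

Lemma computes_functional k (f : recfun k) v y1 y2 :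
  computes f v y1 -> computes f v y2 -> y1 = y2.
Proof.
elim: k / f v y1 y2 => /= [|| k i | m k f IHf g IHg | k f IHf g IHg | k f IHf]
  v y1 y2; try by move=> -> ->.
- move=> [w1 [gw1 fw1]] [w2 [gw2 fw2]].
  suff ew : w1 = w2 by move: fw2; rewrite -ew; apply: IHf.
  by apply: eq_from_tnth => i; apply: IHg (gw1 i) (gw2 i).
- move=> [s1 [f1 g1 ->]] [s2 [f2 g2 ->]].
  suff: forall i, i <= thead v -> s1 i = s2 i by apply.
  elim=> [|i IHi] ltiv; first exact: IHf f1 f2.
  have := g1 _ ltiv; have := g2 _ ltiv; rewrite -(IHi (ltnW ltiv)) => h2 h1.
  exact: IHg h1 h2.
- move=> [f1 lt1] [f2 lt2]; case: (ltngtP y1 y2) => // [/lt2|/lt1] [c fc].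
  + by have := IHf _ _ _ f1 fc.
  + by have := IHf _ _ _ f2 fc.
Qed.

Section InverseMonoids.
Local Open Scope group_scope.
Variable M : monoidType.
Implicit Types (s t x : M) (X : seq M).

Definition is_inverse s t : Prop := s * t * s = s /\ t * s * t = t.

Definition inverse_monoid : Prop := forall s, exists! t, is_inverse s t.

Definition in_sym X x : bool :=
  (x \in X) || `[< exists2 y, y \in X & is_inverse y x >].

Definition generates X : Prop :=
  forall s, exists2 l : seq M, all (in_sym X) l & s = \prod_(x <- l) x.

(* The labels of edges are dropped, as the path metric does not see them. *)
Definition cayley X : rel M :=
  fun s t => `[< exists2 x, in_sym X x & t = s * x >].

End InverseMonoids.

Section Graphs.
Variables (V : eqType) (e : rel V).

Definition reachable (x y : V) : Prop :=
  exists2 p : seq V, path e x p & last x p = y.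

Definition strongly_connected : rel V :=
  fun x y => `[< reachable x y /\ reachable y x >].

Definition component (x : V) := {y : V | strongly_connected x y}.
Definition component_rel (x : V) : rel (component x) :=
  fun y z => e (val y) (val z).

Definition has_walk (x y : V) (k : nat) : bool :=
  `[< exists p : seq V, [/\ path e x p, last x p = y & size p = k] >].

(* The value 0 when there is no walk from x to y is irrelevant: this is only   *)
(* used for graphs in which any two vertices are joined by a walk.             *)
Definition path_dist (x y : V) : nat :=
  if pselect (exists k, has_walk x y k) is left ex then ex_minn ex else 0.

Definition is_tree : Prop :=
  [/\ symmetric e, irreflexive e, forall x y, reachable x y
    & forall c : seq V, ucycle e c -> size c <= 2].

End Graphs.

Section QuasiIsometry.
Local Open Scope ring_scope.
Local Notation R := Rdefinitions.R.

Definition quasi_isometric (X Y : Type) (dX : X -> X -> R) (dY : Y -> Y -> R) :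
    Prop :=
  exists (f : X -> Y) (K C : R),
    [/\ 1 <= K, 0 <= C,
        forall x y, K^-1 * dX x y - C <= dY (f x) (f y) <= K * dX x y + C
      & forall z, exists x, dY z (f x) <= C].

Definition quasi_isometric_to_tree (V : eqType) (e : rel V) : Prop :=
  exists (T : eqType) (t : rel T), is_tree t /\
    quasi_isometric (fun x y => (path_dist e x y)%:R)
                    (fun x y => (path_dist t x y)%:R).

End QuasiIsometry.

Definition tree_like (M : monoidType) : Prop :=
  exists X : seq M, generates X /\
    forall s : M, quasi_isometric_to_tree (@component_rel M (cayley X) s).

(* The generators are 'I_n: (a, false) is the letter a, and (a, true) is its   *)
(* formal inverse.                                                             *)

Definition letter n : Type := ('I_n * bool)%type.
Definition word n : Type := seq ('I_n * bool).

Definition inv_letter n (x : 'I_n * bool) : 'I_n * bool := (x.1, ~~ x.2).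
Definition inv_word n (w : word n) : word n := rev (map (@inv_letter n) w).

Record presentation := Presentation {
  ngens : nat;
  relators : seq (word ngens * word ngens) }.

Inductive tau (P : presentation) : word (ngens P) -> word (ngens P) -> Prop :=
| tau_relator u v : (u, v) \in relators P -> tau u v
| tau_regular u : tau (u ++ inv_word u ++ u) u
| tau_commute u v : tau (u ++ inv_word u ++ v ++ inv_word v)
                        (v ++ inv_word v ++ u ++ inv_word u)
| tau_refl u : tau u u
| tau_sym u v : tau u v -> tau v u
| tau_trans v u w : tau u v -> tau v w -> tau u w
| tau_cat u u' v v' : tau u u' -> tau v v' -> tau (u ++ v) (u' ++ v').

Section InvMonoid.
Variable P : presentation.
Local Notation W := (word (ngens P)).

Definition taub : rel W := fun u v => `[< tau u v >].

Lemma taub_equiv : equiv_class_of taub.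
Proof.
split=> [u | u v | v u w].
- exact/asboolP/tau_refl.
- by apply/asboolP/asboolP; apply: tau_sym.
- move=> /asboolP uv /asboolP vw; exact/asboolP/(tau_trans uv vw).
Qed.

Canonical taub_equiv_rel := EquivRelPack taub_equiv.

Definition Inv := {eq_quot taub}%qT.
HB.instance Definition _ := Choice.on Inv.
HB.instance Definition _ := EqQuotient.on Inv.

Definition cls (u : W) : Inv := \pi_Inv%qT u.

Lemma clsP u v : cls u = cls v <-> tau u v.
Proof.
split=> [/eqmodP/asboolP // | uv]; apply/eqmodP; exact/asboolP.
Qed.

Definition Inv_mul (s t : Inv) : Inv := cls (repr s ++ repr t).

Lemma tau_repr u : tau (repr (cls u)) u.
Proof. by apply/clsP; rewrite /cls reprK. Qed.

Lemma cls_cat u v : cls (u ++ v) = Inv_mul (cls u) (cls v).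
Proof. by apply/clsP/tau_cat; apply/tau_sym/tau_repr. Qed.

Lemma clsE s : s = cls (repr s).
Proof. by rewrite /cls reprK. Qed.

Lemma Inv_mulA : associative Inv_mul.
Proof.
by move=> s t r; rewrite (clsE s) (clsE t) (clsE r) -!cls_cat catA.
Qed.

Lemma Inv_mul1 : left_id (cls [::]) Inv_mul.
Proof. by move=> s; rewrite (clsE s) -cls_cat. Qed.

Lemma Inv_mulr1 : right_id (cls [::]) Inv_mul.
Proof. by move=> s; rewrite (clsE s) -cls_cat cats0. Qed.

End InvMonoid.

HB.instance Definition _ (P : presentation) :=
  isMonoid.Build (Inv P) (@Inv_mulA P) (@Inv_mul1 P) (@Inv_mulr1 P).

Section InvInverse.
Local Open Scope group_scope.
Variable P : presentation.
Implicit Types (s t e f : Inv P) (u v : word (ngens P)).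

Lemma clsM u v : cls (u ++ v) = cls u * cls v :> Inv P.
Proof. exact: cls_cat. Qed.

Lemma inv_wordK n : involutive (@inv_word n).
Proof.
move=> w; rewrite /inv_word map_rev revK -map_comp map_id_in // => -[i b] _.
by rewrite /= /inv_letter /= negbK.
Qed.

Lemma cls_inverse u : is_inverse (cls u : Inv P) (cls (inv_word u)).
Proof.
have cls3 w w' : cls w * cls w' * cls w = cls (w ++ w' ++ w) :> Inv P.
  by rewrite !clsM mulgA.
split; rewrite cls3; apply/clsP; first exact: tau_regular.
by have := tau_regular (inv_word u); rewrite inv_wordK.
Qed.

Lemma cls_commute u v :
  commute (cls u * cls (inv_word u)) (cls v * cls (inv_word v) : Inv P).
Proof.
have cls4 w w' : cls w * cls (inv_word w) * (cls w' * cls (inv_word w')) =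
    cls (w ++ inv_word w ++ w' ++ inv_word w') :> Inv P.
  by rewrite !clsM !mulgA.
rewrite /commute !cls4; apply/clsP; exact: tau_commute.
Qed.

Lemma idem_form e : e * e = e -> exists u, e = cls u * cls (inv_word u).
Proof.
rewrite (clsE e); set u := repr e; move=> ee; exists u.
have [H1 H2] := cls_inverse u.
have C := cls_commute (inv_word u) u; rewrite inv_wordK in C.
move: (cls u) (cls (inv_word u)) ee H1 H2 C => x y xx H1 H2 C.
have y_eq : y = x * y * y * x.
  rewrite -{1}H2 -{1}xx; move: C; rewrite /commute !mulgA => C.
  by rewrite C.
have xy : x * y = y by rewrite {1}y_eq !mulgA xx -y_eq.
have yx : y * x = y by rewrite {1}y_eq -!mulgA xx !mulgA -y_eq.
by rewrite -{1}H1 -mulgA yx.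
Qed.

Lemma idem_commute e f : e * e = e -> f * f = f -> e * f = f * e.
Proof. by move=> /idem_form[u ->] /idem_form[v ->]; apply: cls_commute. Qed.

Lemma Inv_inverse_monoid : inverse_monoid (Inv P).
Proof.
move=> s; exists (cls (inv_word (repr s))).
split=> [|t' [h1 h2]]; first by rewrite {1}[s]clsE; apply: cls_inverse.
have [] := cls_inverse (repr s); rewrite -clsE; set t := cls _ => k1 k2.
have i1 : (s * t) * (s * t) = s * t by rewrite mulgA k1.
have i2 : (s * t') * (s * t') = s * t' by rewrite mulgA h1.
have j1 : (t * s) * (t * s) = t * s by rewrite mulgA k2.
have j2 : (t' * s) * (t' * s) = t' * s by rewrite mulgA h2.
have E1 : t = t * s * t'.
  rewrite -{1}k2 -{1}h1 -!mulgA [s * (t' * _)]mulgA (idem_commute i2 i1).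
  by rewrite !mulgA k2.
rewrite E1 -{2}h2 -{2}k1 !mulgA -(mulgA _ t s) (idem_commute j2 j1).
by rewrite -!mulgA [t' * (s * t')]mulgA h2.
Qed.

End InvInverse.

(* CodeSeq.code is a (computable) bijection from lists of natural numbers to   *)
(* natural numbers.                                                            *)

Definition code_letter n (x : 'I_n * bool) : nat := x.1.*2 + x.2.
Definition code_word n (w : word n) : nat :=
  CodeSeq.code (map (@code_letter n) w).
Definition code_pair n (r : word n * word n) : nat :=
  CodeSeq.code [:: code_word r.1; code_word r.2].
Definition code_relators (P : presentation) : nat :=
  CodeSeq.code (map (@code_pair (ngens P)) (relators P)).

Definition code_input (P : presentation) (u v : word (ngens P)) :
    4.-tuple nat :=
  [tuple ngens P; code_relators P; code_word u; code_word v].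

(* Main.v *)
(* Equality of words is recursively enumerable, so it suffices to certify      *)
(* inequality. If u and v differ, they act differently on the Schuetzenberger  *)
(* graph of one of them, where the relators act alike. This graph is coarsely  *)
(* a tree: cutting a rooted tree into slabs whose height exceeds the distance  *)
(* reached by words of length N gives bags of bounded size, such that a path   *)
(* of length at most N only moves to a parent, a child or a sibling. Bags have *)
(* finitely many isomorphism types; choosing one representative bag of each    *)
(* type and unfolding again yields a graph which looks the same to all words   *)
(* of length at most N, with N exceeding the lengths of the relators and of u  *)
(* and v, but which is the configuration graph of a pushdown automaton. Coding *)
(* stacks as numerals, its letters become partial functions on the natural     *)
(* numbers that are affine on residue classes, and it is decidable whether     *)
(* such functions are mutually inverse, satisfy the relators, and separate u   *)
(* from v. The algorithm searches for a derivation of u = v or for such a      *)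
(* separating automaton.                                                       *)

From HB Require Import structures.
From Stdlib Require Rdefinitions.
Require Import Defs.
From mathcomp Require Import all_boot.
From mathcomp Require Import all_order all_algebra.
From mathcomp Require Import boolp Rstruct zify.

Set Implicit Arguments.
Unset Strict Implicit.
Unset Printing Implicit Defensive.

(** * Recursive functions *)

(** The algorithm is an unbounded search ([recursive_search]) for one of two mutually exclusive
    kinds of witness. Equality is witnessed by a derivation ([derivation_sound],
    [derivation_complete]). Inequality is witnessed by a finitely described partial action of the
    letters on stacks of digits, where a letter rewrites only the two lowest digits. Words then act
    affinely on residue classes, so finitely many tests decide the required identities
    ([srun_agree]). Letters that pass the tests act on valid stacks by partial injections with the
    right inverses, hence [tau]-equivalent words act alike ([tau_wrun], [separates_sound]). All this
    holds for every presentation; tree-likeness enters only in the existence of a witness, and the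
    quasi-isometry constants never enter the algorithm, whence uniformity.

    For the existence, distinct [u] and [v] act differently on the strong component of one of them
    ([tree_like_separates]). A quasi-isometry to a rooted tree, cut into slabs, assigns to each
    vertex a node such that short words move only between close nodes and bags have bounded diameter
    ([coarse_separates]). Up to isomorphism there are finitely many bags; [regularization] picks
    representatives. Unfolding them again gives stack configurations, and [run_conf] shows that
    walks of length at most [N] are simulated faithfully. Since [N] bounds the lengths of the
    relators, of [u] and [v], and of a letter followed by its inverse, the new action passes all
    tests and separates [u] from [v]. *)

Definition env_tuple k (r : nat -> nat) : k.-tuple nat := [tuple r i | i < k].

(* The arity is arbitrary above some bound, so that no arity has to be tracked *)
(* through compositions.                                                       *)
Definition recursive (F : (nat -> nat) -> nat) : Prop :=
  exists m, forall k, m <= k ->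
    exists f : recfun k, forall r, computes f (env_tuple k r) (F r).

Definition scons (x : nat) (r : nat -> nat) (i : nat) : nat :=
  if i is j.+1 then r j else x.

Lemma env_tuple_scons k x r :
  env_tuple k.+1 (scons x r) = [tuple of x :: env_tuple k r].
Proof.
by apply: eq_from_tnth => i; rewrite tnth_mktuple; case: (unliftP ord0 i) =>
  [j|] ->; rewrite ?tnth0 // tnthS tnth_mktuple.
Qed.

Lemma recursive_ext F G : F =1 G -> recursive F -> recursive G.
Proof. by move=> /funext->. Qed.

Lemma recursive_var i : recursive (fun r => r i).
Proof.
exists i.+1 => k ltik; exists (RProj (Ordinal ltik)) => r.
by rewrite /= tnth_mktuple.
Qed.

Lemma recursive_comp F (G : nat -> (nat -> nat) -> nat) :
  recursive F -> (forall i, recursive (G i)) ->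
  recursive (fun r => F (fun i => G i r)).
Proof.
move=> [m Fm] /choice[mG GP].
exists (\max_(i < m) mG i) => k lek; have [f fP] := Fm m (leqnn m).
have /fin_all_exists[g gP] (i : 'I_m) :
    exists g : recfun k, forall r, computes g (env_tuple k r) (G i r).
  by apply: GP; apply: leq_trans lek; apply: (leq_bigmax i).
exists (RComp f g) => r /=; exists (env_tuple m (G^~ r)); split=> // i.
by rewrite tnth_mktuple.
Qed.

Lemma zero_recfun k : exists f : recfun k, forall v, computes f v 0.
Proof.
have /fin_all_exists[g _] (i : 'I_0) : exists g : recfun k, True by case: i.
by exists (RComp RZero g) => v /=; exists [tuple]; split=> // -[].
Qed.

Lemma recursive_zero : recursive (fun=> 0).
Proof. by exists 0 => k _; have [f fP] := zero_recfun k; exists f. Qed.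

Lemma recursive_succ F : recursive F -> recursive (fun r => (F r).+1).
Proof.
move=> [m Fm]; exists m => k /Fm[f fP]; exists (RComp RSucc (fun=> f)) => r.
exists [tuple F r]; split=> [i|]; last by rewrite /= tnth0.
by rewrite (ord1 i) tnth0.
Qed.

Lemma recursive_const n : recursive (fun=> n).
Proof. by elim: n => [|n]; [apply: recursive_zero | apply: recursive_succ]. Qed.

Lemma recursive_iteri (B N : (nat -> nat) -> nat) S :
  recursive B -> recursive N ->
  recursive (fun r => S (r 0) (r 1) (fun i => r i.+2)) ->
  recursive (fun r => iteri (N r) (fun i a => S i a r) (B r)).
Proof.
move=> [mB BP] [mN NP] [mS SP].
exists (maxn mB (maxn mN mS)) => k; rewrite !geq_max => /and3P[leB leN leS].
have [fB fBP] := BP _ leB; have [fN fNP] := NP _ leN.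
have [fS fSP] := SP k.+2 (leqW (leqW leS)).
(* [RPrim] recurses on its first argument: [g] supplies the bound there and passes the other
   variables through. *)
pose g (i : 'I_k.+1) := oapp (@RProj k) fN (unlift ord0 i).
exists (RComp (RPrim fB fS) g) => r.
exists (env_tuple k.+1 (scons (N r) r)); split=> [i|].
  rewrite tnth_mktuple /g; case: unliftP => [j|] -> //=.
  by rewrite tnth_mktuple.
rewrite env_tuple_scons /= theadE.
exists (fun n => iteri n (fun i a => S i a r) (B r)); split=> // [|i ltiN].
- by rewrite (_ : [tuple of _] = env_tuple k r) //; apply/val_inj.
- have := fSP (scons i (scons (iteri i (fun i a => S i a r) (B r)) r)).
  rewrite !env_tuple_scons /=; set t := [tuple of _]; set t' := [tuple of _].
  by rewrite (_ : t = t') //; apply/val_inj.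
Qed.

Notation recursiveb P := (recursive (fun r => nat_of_bool (P r))).

Lemma recursive_pred F : recursive F -> recursive (fun r => (F r).-1).
Proof.
move=> rF; apply: (@recursive_ext (fun r => iteri (F r) (fun i _ => i) 0)).
  by move=> r; case: (F r).
apply: (@recursive_iteri _ _ (fun i _ _ => i)) => //; first exact: recursive_zero.
exact: (recursive_var 0).
Qed.

Section Arithmetic.
Variables F G : (nat -> nat) -> nat.
Hypotheses (rF : recursive F) (rG : recursive G).

Lemma recursive_add : recursive (fun r => F r + G r).
Proof.
apply: (@recursive_ext (fun r => iteri (G r) (fun _ a => a.+1) (F r))) => [r|].
  by elim: (G r) => [|n /= ->]; rewrite ?addn0 ?addnS.
apply: (@recursive_iteri _ _ (fun _ a _ => a.+1)) => //.
exact/recursive_succ/recursive_var.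
Qed.

Lemma recursive_sub : recursive (fun r => F r - G r).
Proof.
apply: (@recursive_ext (fun r => iteri (G r) (fun _ a => a.-1) (F r))) => [r|].
  by elim: (G r) => [|n /= ->]; rewrite ?subn0 ?subnS.
apply: (@recursive_iteri _ _ (fun _ a _ => a.-1)) => //.
exact/recursive_pred/recursive_var.
Qed.

End Arithmetic.

Lemma recursive_mul F G :
  recursive F -> recursive G -> recursive (fun r => F r * G r).
Proof.
move=> rF rG.
apply: (@recursive_ext (fun r => iteri (G r) (fun _ a => a + F r) 0)) => [r|].
  by elim: (G r) => [|n /= ->]; rewrite ?muln0 ?mulnS // addnC.
apply: (@recursive_iteri _ _ (fun _ a r => a + F r)) => //.
  exact: recursive_zero.
apply: recursive_add; first exact: recursive_var.
by apply: (recursive_comp rF) => i; apply: recursive_var.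
Qed.

Lemma recursive_exp F G :
  recursive F -> recursive G -> recursive (fun r => F r ^ G r).
Proof.
move=> rF rG.
apply: (@recursive_ext (fun r => iteri (G r) (fun _ a => a * F r) 1)) => [r|].
  by elim: (G r) => [|n /= ->]; rewrite ?expn0 ?expnSr.
apply: (@recursive_iteri _ _ (fun _ a r => a * F r)) => //.
  exact: recursive_const.
apply: recursive_mul; first exact: recursive_var.
by apply: (recursive_comp rF) => i; apply: recursive_var.
Qed.

Lemma recursive_if P F G : recursiveb P -> recursive F -> recursive G ->
  recursive (fun r => if P r then F r else G r).
Proof.
move=> rP rF rG.
apply: (@recursive_ext (fun r => P r * F r + (1 - P r) * G r)) => [r|].
  by case: (P r); rewrite ?mul1n ?mul0n ?addn0.
apply: recursive_add; apply: recursive_mul => //.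
by apply: recursive_sub => //; apply: recursive_const.
Qed.

Lemma recursive_not P : recursiveb P -> recursiveb (fun r => ~~ P r).
Proof.
move=> rP; apply: (@recursive_ext (fun r => 1 - P r)) => [r|].
  by case: (P r).
by apply: recursive_sub => //; apply: recursive_const.
Qed.

Lemma recursive_and P Q :
  recursiveb P -> recursiveb Q -> recursiveb (fun r => P r && Q r).
Proof.
move=> rP rQ; apply: (@recursive_ext (fun r => P r * Q r)) => [r|].
  by case: (P r) (Q r) => -[].
exact: recursive_mul.
Qed.

Lemma recursive_or P Q :
  recursiveb P -> recursiveb Q -> recursiveb (fun r => P r || Q r).
Proof.
move=> rP rQ; apply: (@recursive_ext (fun r => ~~ (~~ P r && ~~ Q r) : nat)).
  by move=> r; case: (P r) (Q r) => -[].
by apply/recursive_not/recursive_and; apply/recursive_not.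
Qed.

Lemma recursive_imply P Q :
  recursiveb P -> recursiveb Q -> recursiveb (fun r => P r ==> Q r).
Proof.
move=> rP rQ; apply: (@recursive_ext (fun r => ~~ P r || Q r : nat)).
  by move=> r; case: (P r) (Q r) => -[].
by apply/recursive_or => //; apply/recursive_not.
Qed.

Lemma recursive_eq0 F : recursive F -> recursiveb (fun r => F r == 0).
Proof.
move=> rF; apply: (@recursive_ext (fun r => 1 - F r)) => [r|].
  by case: (F r).
by apply: recursive_sub => //; apply: recursive_const.
Qed.

Lemma recursive_leq F G :
  recursive F -> recursive G -> recursiveb (fun r => F r <= G r).
Proof. by move=> rF rG; apply/recursive_eq0/recursive_sub. Qed.

Lemma recursive_ltn F G :
  recursive F -> recursive G -> recursiveb (fun r => F r < G r).
Proof. by move=> rF rG; apply/recursive_leq => //; apply: recursive_succ. Qed.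

Lemma recursive_eq F G :
  recursive F -> recursive G -> recursiveb (fun r => F r == G r).
Proof.
move=> rF rG.
apply: (@recursive_ext (fun r => (F r <= G r) && (G r <= F r) : nat)) => [r|].
  by rewrite eqn_leq.
by apply/recursive_and; apply/recursive_leq.
Qed.

(** * Bounded sums, bounded quantifiers and unbounded search *)

Fixpoint sumb (P : nat -> nat) n := if n is m.+1 then sumb P m + P m else 0.
Fixpoint allb (P : pred nat) n := if n is m.+1 then allb P m && P m else true.
Definition hasb (P : pred nat) n := ~~ allb (fun i => ~~ P i) n.

Lemma allbP (P : pred nat) n : reflect (forall i, i < n -> P i) (allb P n).
Proof.
elim: n => [|n IHn] /=; first by constructor.
apply: (iffP andP) => [[/IHn Pn Pn1] i | Pn].
  by rewrite ltnS leq_eqVlt => /predU1P[->|/Pn].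
by split; [apply/IHn => i /leqW/Pn | apply: Pn].
Qed.

Lemma hasbP (P : pred nat) n : reflect (exists2 i, i < n & P i) (hasb P n).
Proof.
apply: (iffP idP) => [|[i ltin Pi]].
  by apply: contraNP => nP; apply/allbP => i ltin; apply/negP => Pi; case: nP; exists i.
by apply/negP => /allbP/(_ i ltin); rewrite Pi.
Qed.

Lemma recursive_sumb (P : nat -> (nat -> nat) -> nat) N : recursive N ->
  recursive (fun r => P (r 0) (fun i => r i.+1)) ->
  recursive (fun r => sumb (fun i => P i r) (N r)).
Proof.
move=> rN rP.
apply: (@recursive_ext (fun r => iteri (N r) (fun i a => a + P i r) 0)) => [r|].
  by elim: (N r) => //= n ->.
apply: (@recursive_iteri _ _ (fun i a r => a + P i r)) => //.
  exact: recursive_zero.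
apply: recursive_add; first exact: recursive_var.
apply: (recursive_comp rP (G := fun i r => if i is j.+1 then r j.+2 else r 0)).
by case=> [|i]; apply: recursive_var.
Qed.

Lemma recursive_allb (P : nat -> (nat -> nat) -> bool) N : recursive N ->
  recursiveb (fun r => P (r 0) (fun i => r i.+1)) ->
  recursiveb (fun r => allb (fun i => P i r) (N r)).
Proof.
move=> rN rP.
apply: (@recursive_ext (fun r => sumb (fun i => ~~ P i r) (N r) == 0 : nat)).
  move=> r; congr nat_of_bool.
  by elim: (N r) => //= n <-; rewrite addn_eq0 eqb0 negbK.
apply: recursive_eq0.
apply: (@recursive_sumb (fun i r => ~~ P i r)) => //.
exact: (@recursive_not (fun r => P (r 0) (fun i => r i.+1))).
Qed.

Lemma recursive_hasb (P : nat -> (nat -> nat) -> bool) N : recursive N ->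
  recursiveb (fun r => P (r 0) (fun i => r i.+1)) ->
  recursiveb (fun r => hasb (fun i => P i r) (N r)).
Proof.
move=> rN rP; apply: recursive_not.
apply: (@recursive_allb (fun i r => ~~ P i r)) => //.
exact: (@recursive_not (fun r => P (r 0) (fun i => r i.+1))).
Qed.

(** The quotient counts the positive multiples of [d] up to [m]; the guard yields the convention
    [m %/ 0 = 0]. *)
Lemma divn_sumb m d : m %/ d = sumb (fun i => (0 < d) && (d * i.+1 <= m)) m.
Proof.
case: (posnP d) => [->|d0] /=.
  by rewrite divn0; elim: m => //= n <-.
suff H n : sumb (fun i => d * i.+1 <= m) n = minn n (m %/ d).
  by rewrite H; apply/esym/minn_idPr/leq_div.
elim: n => /= [|n ->]; first by rewrite min0n.
rewrite mulnC -leq_divRL //; case: (ltnP n) => lt.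
  by rewrite (minn_idPl lt) addn1.
by rewrite addn0 (minn_idPr (leqW lt)).
Qed.

Lemma recursive_div F G :
  recursive F -> recursive G -> recursive (fun r => F r %/ G r).
Proof.
move=> rF rG; apply: (recursive_ext (fun r => esym (divn_sumb (F r) (G r)))).
apply: (@recursive_sumb (fun i r => (0 < G r) && (G r * i.+1 <= F r))) => //.
have rG' : recursive (fun r => G (fun i => r i.+1)).
  by apply: (recursive_comp rG) => i; apply: recursive_var.
have rF' : recursive (fun r => F (fun i => r i.+1)).
  by apply: (recursive_comp rF) => i; apply: recursive_var.
apply/recursive_and; first exact: recursive_ltn recursive_zero _.
by apply: recursive_leq (recursive_mul _ (recursive_succ (recursive_var 0))) _.
Qed.

Lemma recursive_mod F G :
  recursive F -> recursive G -> recursive (fun r => F r %% G r).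
Proof.
move=> rF rG.
apply: (@recursive_ext (fun r => F r - F r %/ G r * G r)) => [r|].
  by rewrite {1}(divn_eq (F r) (G r)) addKn.
by apply/recursive_sub => //; apply/recursive_mul => //; apply/recursive_div.
Qed.

Lemma recursive_search n (P Q : (nat -> nat) -> bool) :
  recursiveb P -> recursiveb Q ->
  exists f : recfun n, forall v : n.-tuple nat,
    (exists c, P (scons c (nth 0 v))) ->
    exists c, P (scons c (nth 0 v)) /\ computes f v (Q (scons c (nth 0 v))).
Proof.
move=> /recursive_not [mP PP] [mQ QP]; pose k := maxn mP mQ.
have [p pP] := PP k.+1 (leqW (leq_maxl mP mQ)).
have [q qP] := QP k.+1 (leqW (leq_maxr mP mQ)).
pose g (i : 'I_k.+1) := oapp (@RProj k) (RMin p) (unlift ord0 i).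
(* The environment is the input tuple continued by zeros, so projections beyond the arity [n] become
   the zero function. *)
have /fin_all_exists[h hP] (i : 'I_k) :
    exists h : recfun n, forall v : n.-tuple nat, computes h v (nth 0 v i).
  have [ltin|lein] := ltnP i n.
    by exists (RProj (Ordinal ltin)) => v; rewrite /= (tnth_nth 0).
  have [h hP] := zero_recfun n.
  by exists h => v; rewrite nth_default ?size_tuple.
exists (RComp (RComp q g) h) => v exP; set r := nth 0 v in exP *.
have [c Pc minc] := ex_minnP exP.
exists c; split=> //=; exists (env_tuple k r); split=> [i|].
  by rewrite tnth_mktuple.
exists (env_tuple k.+1 (scons c r)); split=> // i.
rewrite tnth_mktuple /g; case: unliftP => [j|] -> //=.
  by rewrite tnth_mktuple.
split=> [|z ltzc]; first by have := pP (scons c r); rewrite Pc env_tuple_scons.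
exists 0; have := pP (scons z r); rewrite env_tuple_scons.
by case Pz: (P (scons z r)) => //; have := minc z Pz; rewrite leqNgt ltzc.
Qed.

(** * Coded lists *)

Ltac recursive_hook := fail.
Ltac recursive_step :=
  cbv beta; try assumption;
  lazymatch goal with
  | |- recursive (fun r => r _) => exact: recursive_var
  | |- recursive (fun _ => ?c) => exact: recursive_const
  | |- recursive (fun r => (@?F r).+1) => apply: recursive_succ
  | |- recursive (fun r => (@?F r).-1) => apply: recursive_pred
  | |- recursive (fun r => @?F r + @?G r) => apply: recursive_add
  | |- recursive (fun r => @?F r - @?G r) => apply: recursive_sub
  | |- recursive (fun r => @?F r * @?G r) => apply: recursive_mul
  | |- recursive (fun r => @?F r ^ @?G r) => apply: recursive_exp
  | |- recursive (fun r => @?F r %/ @?G r) => apply: recursive_div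
  | |- recursive (fun r => @?F r %% @?G r) => apply: recursive_mod
  | |- recursive (fun r => nat_of_bool (~~ @?P r)) => apply: recursive_not
  | |- recursive (fun r => nat_of_bool (@?P r && @?Q r)) => apply: recursive_and
  | |- recursive (fun r => nat_of_bool (@?P r || @?Q r)) => apply: recursive_or
  | |- recursive (fun r => nat_of_bool (@?P r ==> @?Q r)) => apply: recursive_imply
  | |- recursive (fun r => nat_of_bool (@?F r <= @?G r)) => apply: recursive_leq
  | |- recursive (fun r => nat_of_bool (@?F r == @?G r)) => apply: recursive_eq
  | |- recursive (fun r => nat_of_bool (allb _ _)) => apply: recursive_allb
  | |- recursive (fun r => nat_of_bool (hasb _ _)) => apply: recursive_hasb
  | |- recursive (fun r => sumb _ _) => apply: recursive_sumb
  | |- recursive (fun r => iteri _ _ _) => apply: recursive_iteri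
  | |- recursive (fun r => if _ then _ else _) => apply: recursive_if
  | |- _ => recursive_hook
  end.
Ltac recursive_tac := repeat recursive_step.

Lemma recursive1 (f : nat -> nat) F :
  recursive (fun r => f (r 0)) -> recursive F -> recursive (fun r => f (F r)).
Proof. by move=> rf rF; apply: (recursive_comp rf (G := fun _ r => F r)). Qed.

Lemma recursive2 (f : nat -> nat -> nat) F G :
  recursive (fun r => f (r 0) (r 1)) -> recursive F -> recursive G ->
  recursive (fun r => f (F r) (G r)).
Proof.
move=> rf rF rG.
by apply: (recursive_comp rf (G := fun i r => if i is 0 then F r else G r)) => -[].
Qed.

Lemma recursive3 (f : nat -> nat -> nat -> nat) F G H :
  recursive (fun r => f (r 0) (r 1) (r 2)) ->
  recursive F -> recursive G -> recursive H ->
  recursive (fun r => f (F r) (G r) (H r)).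
Proof.
move=> rf rF rG rH.
apply: (recursive_comp rf (G := fun i r =>
  match i with 0 => F r | 1 => G r | _ => H r end)).
by move=> [|[]].
Qed.


Local Notation code := CodeSeq.code.
Local Notation decode := CodeSeq.decode.

Definition ncons x c := 2 ^ x * (c + c).+1.
Definition nhd c := head 0 (decode c).
Definition ntl c := code (behead (decode c)).
Definition nsize c := size (decode c).
Definition nnth c i := nth 0 (decode c) i.
Definition ncat c d := code (decode c ++ decode d).

Lemma nconsE x s : ncons x (code s) = code (x :: s).
Proof. by rewrite /ncons addnn. Qed.

Lemma recursive_ncons F G :
  recursive F -> recursive G -> recursive (fun r => ncons (F r) (G r)).
Proof. by move=> rF rG; rewrite /ncons; recursive_tac. Qed.

(** The code of [x :: s] is [2 ^ x] times an odd number, so the head is a 2-adic valuation; the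
    guard covers the empty list, whose code is 0. *)
Lemma nhdE c : nhd c = sumb (fun i => (0 < c) && (c %% 2 ^ i.+1 == 0)) c.
Proof.
rewrite -[c in RHS]CodeSeq.decodeK /nhd.
case: (decode c) => [|x s] //=; set y := code s; set d := _ * _.
have d0 : 0 < d by rewrite muln_gt0 expn_gt0.
rewrite d0 /=; suff H n : sumb (fun i => d %% 2 ^ i.+1 == 0) n = minn n x.
  rewrite H; apply/esym/minn_idPr; apply: leq_trans (ltnW (ltn_expl x (ltnSn 1))) _.
  by rewrite /d leq_pmulr.
elim: n => /= [|n ->]; first by rewrite min0n.
have -> : (d %% 2 ^ n.+1 == 0) = (n < x).
  rewrite -/(dvdn _ _) /d; case: (ltnP n x) => [lt|le].
    by rewrite dvdn_mulr // dvdn_exp2l.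
  rewrite -(subnKC le) -addnS expnD dvdn_pmul2l ?expn_gt0 // expnS.
  by apply/negP => /(dvdn_trans (dvdn_mulr _ (dvdnn 2))); rewrite dvdn2 /= odd_double.
by case: (ltnP n x) => lt; rewrite ?(minn_idPl lt) ?addn1 // addn0 (minn_idPr _) // leqW.
Qed.

Lemma recursive_nhd F : recursive F -> recursive (fun r => nhd (F r)).
Proof.
apply: recursive1; apply: (recursive_ext (fun r => esym (nhdE (r 0)))).
by recursive_tac.
Qed.

Lemma ntlE c : ntl c = c %/ 2 ^ nhd c %/ 2.
Proof.
rewrite /ntl -[c in RHS]CodeSeq.decodeK /nhd CodeSeq.codeK.
case: (decode c) => [|x s] //=.
by rewrite mulKn ?expn_gt0 // divn2 /= uphalf_double.
Qed.

Lemma recursive_ntl F : recursive F -> recursive (fun r => ntl (F r)).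
Proof.
apply: recursive1; apply: (recursive_ext (fun r => esym (ntlE (r 0)))).
by recursive_tac; apply: recursive_nhd; recursive_tac.
Qed.

Lemma iter_ntl c i : iteri i (fun _ a => ntl a) c = code (drop i (decode c)).
Proof.
elim: i => /= [|i ->]; first by rewrite drop0 CodeSeq.decodeK.
by rewrite /ntl CodeSeq.codeK -drop1 drop_drop.
Qed.

Lemma nnthE c i : nnth c i = nhd (iteri i (fun _ a => ntl a) c).
Proof. by rewrite iter_ntl /nhd CodeSeq.codeK -nth0 nth_drop addn0. Qed.

Lemma recursive_nnth F G :
  recursive F -> recursive G -> recursive (fun r => nnth (F r) (G r)).
Proof.
apply: recursive2; apply: (recursive_ext (fun r => esym (nnthE (r 0) (r 1)))).
apply: recursive_nhd; apply: recursive_iteri; recursive_tac.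
by apply: recursive_ntl; recursive_tac.
Qed.

Lemma code_eq0 s : (code s == 0) = nilp s.
Proof. by case: s => //= x s; rewrite muln_eq0 expn_eq0. Qed.

Lemma size_decode c : size (decode c) <= c.
Proof.
rewrite -[c in _ <= c]CodeSeq.decodeK; elim: (decode c) => //= x s IHs.
rewrite (leq_trans (n := (code s).*2.+1)) ?leq_pmull ?expn_gt0 //.
by rewrite ltnS (leq_trans IHs) // -addnn leq_addl.
Qed.

(** Only the empty list has code 0, so the length counts the iterated tails that are nonzero; it is
    at most the code itself. *)
Lemma nsizeE c :
  nsize c = sumb (fun i => iteri i (fun _ a => ntl a) c != 0) c.
Proof.
rewrite /nsize.
suff H n : sumb (fun i => iteri i (fun _ a => ntl a) c != 0) n = minn n (size (decode c)).
  by rewrite H; apply/esym/minn_idPr/size_decode.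
elim: n => /= [|n ->]; first by rewrite min0n.
rewrite iter_ntl code_eq0 /nilp size_drop subn_eq0 -ltnNge.
by case: (ltnP n) => lt; rewrite ?(minn_idPl lt) ?addn1 // addn0 (minn_idPr _) // leqW.
Qed.

Lemma recursive_nsize F : recursive F -> recursive (fun r => nsize (F r)).
Proof.
apply: recursive1; apply: (recursive_ext (fun r => esym (nsizeE (r 0)))).
recursive_tac.
by apply: recursive_ntl; recursive_tac.
Qed.

Ltac recursive_hook ::=
  lazymatch goal with
  | |- recursive (fun r => ncons _ _) => apply: recursive_ncons
  | |- recursive (fun r => nnth _ _) => apply: recursive_nnth
  | |- recursive (fun r => nsize _) => apply: recursive_nsize
  end.

Lemma iteri_nnth T (f : T -> nat -> T) z c n : n <= nsize c ->
  iteri n (fun i a => f a (nnth c i)) z = foldl f z (take n (decode c)).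
Proof.
elim: n => [|n IHn] len /=; first by rewrite take0.
by rewrite IHn ?(ltnW len) // (take_nth 0) // -cats1 foldl_cat.
Qed.

Lemma foldl_nnth T (f : T -> nat -> T) z c :
  foldl f z (decode c) = iteri (nsize c) (fun i a => f a (nnth c i)) z.
Proof. by rewrite iteri_nnth // take_size. Qed.

Definition nrev c := code (rev (decode c)).

Lemma nrevE c : nrev c = iteri (nsize c) (fun i a => ncons (nnth c i) a) 0.
Proof.
rewrite -(foldl_nnth (fun a x => ncons x a)) /nrev -{2}(revK (decode c)) foldl_rev.
by elim: (rev _) => //= x s IHs; rewrite -IHs nconsE.
Qed.

Lemma ncatE c d :
  ncat c d = iteri (nsize (nrev c)) (fun i a => ncons (nnth (nrev c) i) a) d.
Proof.
rewrite -(foldl_nnth (fun a x => ncons x a)) /nrev CodeSeq.codeK foldl_rev /ncat.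
rewrite -[d in RHS]CodeSeq.decodeK.
by elim: (decode c) => //= x s IHs; rewrite -IHs nconsE.
Qed.

(** Formal inversion on letter codes: [2 * i] codes a generator and [2 * i + 1] its inverse. *)
Definition flip a := if a %% 2 == 0 then a.+1 else a.-1.
Definition ninv c := code (rev (map flip (decode c))).

Lemma ninvE c : ninv c = iteri (nsize c) (fun i a => ncons (flip (nnth c i)) a) 0.
Proof.
rewrite -(foldl_nnth (fun a x => ncons (flip x) a)) /ninv -map_rev.
rewrite -{2}(revK (decode c)) foldl_rev.
by elim: (rev _) => //= x s IHs; rewrite -IHs nconsE.
Qed.

Lemma recursive_flip F : recursive F -> recursive (fun r => flip (F r)).
Proof. by move=> rF; rewrite /flip; recursive_tac. Qed.

Lemma recursive_nrev F : recursive F -> recursive (fun r => nrev (F r)).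
Proof.
apply: recursive1; apply: (recursive_ext (fun r => esym (nrevE (r 0)))).
by recursive_tac.
Qed.

Lemma recursive_ncat F G :
  recursive F -> recursive G -> recursive (fun r => ncat (F r) (G r)).
Proof.
apply: recursive2; apply: (recursive_ext (fun r => esym (ncatE (r 0) (r 1)))).
by apply: recursive_iteri; recursive_tac; apply: recursive_nrev; recursive_tac.
Qed.

Lemma recursive_ninv F : recursive F -> recursive (fun r => ninv (F r)).
Proof.
apply: recursive1; apply: (recursive_ext (fun r => esym (ninvE (r 0)))).
by recursive_tac; apply: recursive_flip; recursive_tac.
Qed.

(** * Derivations *)

(* A derivation lists entries [lhs; rhs; a; b], whose premises come later in    *)
(* the list; a and b are only used by the commutation rule.                    *)
Definition lhs d i := nnth (nnth d i) 0.
Definition rhs d i := nnth (nnth d i) 1.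

(** The alternatives follow the constructors of [tau]. Requiring [i < j] and [i < k] excludes
    circular derivations; symmetry reads the premise [j] only. *)
Definition rule R d i :=
  [|| hasb (fun j => (lhs d i == lhs R j) && (rhs d i == rhs R j)) (nsize R),
      lhs d i == ncat (rhs d i) (ncat (ninv (rhs d i)) (rhs d i)),
      let a := nnth (nnth d i) 2 in let b := nnth (nnth d i) 3 in
        (lhs d i == ncat a (ncat (ninv a) (ncat b (ninv b)))) &&
        (rhs d i == ncat b (ncat (ninv b) (ncat a (ninv a)))),
      lhs d i == rhs d i
    | hasb (fun j => hasb (fun k => [&& i < j, i < k &
        [|| (lhs d j == rhs d i) && (rhs d j == lhs d i),
            [&& lhs d j == lhs d i, rhs d j == lhs d k & rhs d k == rhs d i]
          | (lhs d i == ncat (lhs d j) (lhs d k)) &&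
            (rhs d i == ncat (rhs d j) (rhs d k))]]) (nsize d)) (nsize d)].

Definition derivation R u v d :=
  [&& 0 < nsize d, lhs d 0 == u, rhs d 0 == v & allb (rule R d) (nsize d)].

Lemma recursive_derivation F G H K :
  recursive F -> recursive G -> recursive H -> recursive K ->
  recursiveb (fun r => derivation (F r) (G r) (H r) (K r)).
Proof.
move=> rF rG rH rK.
apply: (recursive_comp (F := fun r => derivation (r 0) (r 1) (r 2) (r 3))
  (G := fun i => nth F [:: F; G; H; K] i)); last first.
  by move=> [|[|[|[|i]]]] //=; rewrite nth_nil.
rewrite /derivation /rule /lhs /rhs.
by repeat first [apply: recursive_ncat | apply: recursive_ninv | recursive_step].
Qed.

(** * Decoding words; soundness and completeness of derivations *)

Section Letters.
Variable n : nat.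

Definition decode_letter (a : nat) : option ('I_n * bool) :=
  omap (pair^~ (odd a)) (insub a./2).
(** Numbers that code no letter are dropped. Decoding thus respects concatenation and inversion on
    all numbers, and entries of a derivation need not be checked to be words. *)
Definition decode_word (c : nat) : word n := pmap decode_letter (decode c).

Lemma code_letterK : pcancel (@code_letter n) decode_letter.
Proof.
case=> i b; rewrite /decode_letter /code_letter /= addnC half_bit_double.
by rewrite valK /= oddD odd_double addbF oddb.
Qed.

Lemma code_wordK : cancel (@code_word n) decode_word.
Proof.
by move=> w; rewrite /decode_word /code_word CodeSeq.codeK (map_pK code_letterK).
Qed.

Lemma decode_letter_flip a :
  decode_letter (flip a) = omap (@inv_letter n) (decode_letter a).
Proof.
rewrite /decode_letter /flip modn2 eqb0.
have -> : (if ~~ odd a then a.+1 else a.-1)./2 = a./2.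
  case: ifPn => oa; first by rewrite -[a.+1./2]/(uphalf a) uphalf_half (negPf oa).
  by move/negPn: oa; case: a => //= a /negPf oa; rewrite uphalf_half oa.
case: insub => //= i; congr (Some (_, _)).
by case: ifPn => // /negPn; case: a => //= a /negPf.
Qed.

Lemma decode_word_cat c d :
  decode_word (ncat c d) = decode_word c ++ decode_word d.
Proof. by rewrite /decode_word /ncat CodeSeq.codeK pmap_cat. Qed.

Lemma decode_word_inv c : decode_word (ninv c) = inv_word (decode_word c).
Proof.
rewrite /decode_word /ninv CodeSeq.codeK /inv_word.
elim: (decode c) => //= a s IHs.
rewrite rev_cons -cats1 pmap_cat IHs /= decode_letter_flip.
by case: decode_letter => [x|] /=; rewrite ?cats0 // rev_cons cats1.
Qed.

Lemma code_word_cat (u v : word n) :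
  code_word (u ++ v) = ncat (code_word u) (code_word v).
Proof. by rewrite /ncat /code_word !CodeSeq.codeK map_cat. Qed.

Lemma flip_code_letter (x : 'I_n * bool) :
  code_letter (inv_letter x) = flip (code_letter x).
Proof.
case: x => i b; rewrite /flip /code_letter modn2 /= oddD odd_double oddb.
by case: b => /=; rewrite ?addn0 ?addn1.
Qed.

Lemma code_word_inv (u : word n) :
  code_word (inv_word u) = ninv (code_word u).
Proof.
rewrite /ninv /code_word CodeSeq.codeK map_rev -!map_comp; congr (code (rev _)).
by apply: eq_map => x; apply: flip_code_letter.
Qed.

End Letters.

Section Derivations.
Variable P : presentation.
Local Notation R := (code_relators P).

Lemma lhs_relators j : j < size (relators P) ->
  lhs R j = code_word (nth ([::], [::]) (relators P) j).1 /\
  rhs R j = code_word (nth ([::], [::]) (relators P) j).2.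
Proof.
move=> lt; rewrite /lhs /rhs /nnth /code_relators CodeSeq.codeK.
by rewrite (nth_map ([::], [::])) // /code_pair CodeSeq.codeK.
Qed.

Lemma size_relators : nsize R = size (relators P).
Proof. by rewrite /nsize CodeSeq.codeK size_map. Qed.

Lemma derivation_sound u v d :
  derivation R u v d -> tau (decode_word (ngens P) u) (decode_word (ngens P) v).
Proof.
case/and4P=> d0 /eqP<- /eqP<- /allbP rules.
have [m] : exists m, nsize d <= m by exists (nsize d).
(* Induction on a bound for the number of entries from [i] on, since premises come later. *)
rewrite -[m]addn0; elim: m 0 d0 => [|m IHm] i ltid lem.
  by rewrite leqNgt ltid in lem.
case/or4P: (rules i ltid).
- case/hasbP=> j; rewrite size_relators => ltj /andP[/eqP-> /eqP->].
  have [-> ->] := lhs_relators ltj; rewrite !code_wordK.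
  by apply: tau_relator; rewrite -surjective_pairing mem_nth.
- by move/eqP->; rewrite !decode_word_cat decode_word_inv; apply: tau_regular.
- case/andP=> /eqP-> /eqP->; rewrite !decode_word_cat !decode_word_inv.
  exact: tau_commute.
- case/orP=> [/eqP-> | /hasbP[j ltj /hasbP[k ltk]]]; first exact: tau_refl.
  case/and3P=> ltij ltik.
  have tj : tau (decode_word (ngens P) (lhs d j)) (decode_word (ngens P) (rhs d j)).
    by apply: IHm; rewrite // (leq_trans lem) // addSnnS leq_add2l.
  have tk : tau (decode_word (ngens P) (lhs d k)) (decode_word (ngens P) (rhs d k)).
    by apply: IHm; rewrite // (leq_trans lem) // addSnnS leq_add2l.
  case/or3P.
  + by case/andP=> /eqP<- /eqP<-; apply: tau_sym.
  + by case/and3P=> /eqP<- /eqP e /eqP<-; rewrite e in tj; apply: tau_trans tk.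
  + by case/andP=> /eqP-> /eqP->; rewrite !decode_word_cat; apply: tau_cat.
Qed.

(** Premises are sought anywhere later in the list, so a block of justified entries stays justified
    when it is moved inside a longer list. *)
Lemma rule_shift L L' k i : i < size L -> size L + k <= size L' ->
  (forall j, j < size L -> nth 0 L' (j + k) = nth 0 L j) ->
  rule R (code L) i -> rule R (code L') (i + k).
Proof.
move=> lti leL eL; have eN j : j < size L -> nnth (code L') (j + k) = nnth (code L) j.
  by move=> ltj; rewrite /nnth !CodeSeq.codeK eL.
rewrite /rule /lhs /rhs !eN // => /or4P[->|->|->|]; rewrite ?orbT //.
case/orP=> [->|]; rewrite ?orbT // => /hasbP[j + /hasbP[l]].
rewrite /nsize !CodeSeq.codeK => ltj ltl /and3P[ij il H].
apply/orP; right; apply/orP; right; apply/orP; right; apply/orP; right.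
have bound m : m < size L -> m + k < size L'.
  by move=> ltm; rewrite (leq_trans _ leL) // ltn_add2r.
apply/hasbP; exists (j + k); first exact: bound.
apply/hasbP; exists (l + k); first exact: bound.
by rewrite !ltn_add2r ij il /= !eN.
Qed.

Lemma rules_cat L1 L2 : allb (rule R (code L1)) (size L1) ->
  allb (rule R (code L2)) (size L2) ->
  allb (rule R (code (L1 ++ L2))) (size (L1 ++ L2)).
Proof.
move=> /allbP r1 /allbP r2; apply/allbP => i; rewrite size_cat.
case: (ltnP i (size L1)) => [lti _|lei].
  rewrite -[i]addn0; apply: rule_shift (r1 i lti); rewrite ?addn0 //.
    by rewrite size_cat leq_addr.
  by move=> j ltj; rewrite addn0 nth_cat ltj.
rewrite -{2}(subnK lei) -ltn_subLR // => lti.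
apply: rule_shift (r2 _ lti) => //; first by rewrite size_cat addnC.
by move=> j ltj; rewrite nth_cat ltnNge leq_addl /= addnK.
Qed.

Lemma rules_cons x L : rule R (code (x :: L)) 0 ->
  allb (rule R (code L)) (size L) ->
  allb (rule R (code (x :: L))) (size (x :: L)).
Proof.
move=> rx /allbP rL; apply/allbP => -[|i] // lti; rewrite -[i.+1]addn1.
by apply: rule_shift (rL i lti); rewrite ?addn1 // => j _; rewrite addn1.
Qed.

Lemma derivation_complete (u v : word (ngens P)) : tau u v ->
  exists d, derivation R (code_word u) (code_word v) d.
Proof.
have E x y a b L : let d := code (code [:: x; y; a; b] :: L) in
    (lhs d 0 = x) * (rhs d 0 = y) * (nnth (nnth d 0) 2 = a) *
    (nnth (nnth d 0) 3 = b) * (nsize d = (size L).+1).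
  by rewrite /lhs /rhs /nsize /nnth !CodeSeq.codeK.
have E1 x L i : let d := code (x :: L) in
    (lhs d i.+1 = lhs (code L) i) * (rhs d i.+1 = rhs (code L) i).
  by rewrite /lhs /rhs /nnth !CodeSeq.codeK.
have base x y a b : rule R (code [:: code [:: x; y; a; b]]) 0 ->
    exists d, derivation R x y d.
  move=> r; exists (code [:: code [:: x; y; a; b]]).
  by rewrite /derivation !E !eqxx /= r.
have main x y L : rule R (code (code [:: x; y; 0; 0] :: L)) 0 ->
    allb (rule R (code L)) (size L) -> exists d, derivation R x y d.
  move=> r0 rL; exists (code (code [:: x; y; 0; 0] :: L)).
  by rewrite /derivation !E !eqxx rules_cons.
have split2 x y d : derivation R x y d -> exists L,
    [/\ allb (rule R (code L)) (size L), 0 < size L,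
        lhs (code L) 0 = x & rhs (code L) 0 = y].
  case/and4P=> s0 /eqP<- /eqP<- rd; exists (decode d).
  by rewrite CodeSeq.decodeK.
have right5 (a b c d e : bool) : e -> [|| a, b, c, d | e] by move=> ->; rewrite !orbT.
elim=> {u v} [u v uv | u | u v | u | u v _ [d Hd] | v u w _ [d1 Hd1] _ [d2 Hd2]
             | u u' v v' _ [d1 Hd1] _ [d2 Hd2]].
- apply: (base _ _ 0 0); rewrite /rule !E; apply/orP; left; apply/hasbP.
  exists (index (u, v) (relators P)); rewrite ?size_relators ?index_mem //.
  by have [-> ->] := @lhs_relators (index (u, v) (relators P))
     (eq_trans (index_mem _ _) uv); rewrite nth_index ?eqxx.
- apply: (base _ _ 0 0); rewrite /rule !E !code_word_cat code_word_inv eqxx.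
  by rewrite orbT.
- apply: (base _ _ (code_word u) (code_word v)); rewrite /rule !E.
  by rewrite !code_word_cat !code_word_inv !eqxx !orbT.
- by apply: (base _ _ 0 0); rewrite /rule !E eqxx !orbT.
- have [L [rL L0 eu ev]] := split2 _ _ _ Hd.
  (* Below the new head the old conclusion sits at position 1; it also fills the slot of the second
     premise. *)
  apply: main rL; apply/right5; rewrite !E; apply/hasbP; exists 1 => //.
  by apply/hasbP; exists 1; rewrite // !E1 eu ev !eqxx.
- have [L1 [rL1 L10 eu1 ev1]] := split2 _ _ _ Hd1.
  have [L2 [rL2 L20 eu2 ev2]] := split2 _ _ _ Hd2.
  apply: main (rules_cat rL1 rL2); apply/right5; rewrite !E size_cat.
  apply/hasbP; exists 1; first by rewrite ltnS addn_gt0 L10.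
  apply/hasbP; exists (size L1).+1.
    by rewrite ltnS -[X in X < _]addn0 ltn_add2l.
  move: eu1 ev1 eu2 ev2.
  rewrite !E1 /lhs /rhs /nnth !CodeSeq.codeK !nth_cat L10 ltnn subnn.
  by move=> -> -> -> ->; rewrite !eqxx /= !orbT.
- have [L1 [rL1 L10 eu1 ev1]] := split2 _ _ _ Hd1.
  have [L2 [rL2 L20 eu2 ev2]] := split2 _ _ _ Hd2.
  apply: main (rules_cat rL1 rL2); apply/right5; rewrite !E size_cat.
  apply/hasbP; exists 1; first by rewrite ltnS addn_gt0 L10.
  apply/hasbP; exists (size L1).+1.
    by rewrite ltnS -[X in X < _]addn0 ltn_add2l.
  move: eu1 ev1 eu2 ev2.
  rewrite !E1 /lhs /rhs /nnth !CodeSeq.codeK !nth_cat L10 ltnn subnn.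
  by move=> -> -> -> ->; rewrite !code_word_cat !eqxx /= !orbT.
Qed.

End Derivations.

(** * Separating certificates *)

(* A certificate lists a base (minus 2), a transition table, two adjacency     *)
(* tables and a start. It describes a graph on natural numbers, seen as stacks *)
(* of digits: digit 0 is a vertex of a bag, digits 1, 2, ... are the nodes     *)
(* above it, and the infinitely many zeros stand for the root. An entry e of   *)
(* the table replaces digits 0 and 1 by the e %% 4 digits of e %/ 4, no edge   *)
(* being encoded by e %% 4 = 0. In the values of [step] and [run], 0 means     *)
(* undefined and t.+1 means t.                                                 *)
Definition base c := (nnth c 0).+2.
Definition digit c s i := s %/ base c ^ i %% base c.

Definition entry c a s :=
  nnth (nnth c 1) ((a * base c + digit c s 0) * base c + digit c s 1).

Definition step c a s :=
  let e := entry c a s in let k := e %% 4 in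
  if k == 0 then 0
  else ((e %/ 4) %% base c ^ k + base c ^ k * (s %/ base c ^ 2)).+1.

Definition run c w s :=
  iteri (nsize w) (fun i t => if t == 0 then 0 else step c (nnth w i) t.-1) s.+1.

(** Validity is local: a vertex must fit the node above it, and each node the next one. [valid c j]
    inspects digits 0 to [j + 1] only. *)
Definition valid_top c s :=
  nnth (nnth c 2) (digit c s 0 * base c + digit c s 1) != 0.
Definition valid_below c s i :=
  nnth (nnth c 3) (digit c s i.+1 * base c + digit c s i.+2) != 0.
Definition valid c j s := valid_top c s && allb (valid_below c s) j.

(* Runs are affine on the residue classes modulo [base c ^ j], so that testing *)
(* two elements of each class is enough.                                       *)
Definition respects c l r :=
  let j := 2 * (nsize l + nsize r) in
  allb (fun s => valid c j s ==> (run c l s == run c r s)) (2 * base c ^ j.+2).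

(** Six digits suffice: [valid c 4] reads six and two steps depend on at most four. After a step
    that writes [k] digits, only the top adjacency and the next [k - 1] can be new. *)
Definition good_letter c a :=
  allb (fun s => valid c 4 s && (step c a s != 0) ==>
     (step c (flip a) (step c a s).-1 == s.+1) &&
     valid c (entry c a s %% 4).-1 (step c a s).-1) (2 * base c ^ 6).

(** A start [s] is less than [base c ^ s], so its digits from position [s] on are zero; as node 0
    may lie above node 0, [valid c s s] then covers the whole infinite stack. *)
Definition separates n R u v c :=
  [&& allb (good_letter c) (2 * n),
      allb (fun i => respects c (lhs R i) (rhs R i)) (nsize R),
      valid c (nnth c 4) (nnth c 4), nnth (nnth c 3) 0 != 0
    & run c u (nnth c 4) != run c v (nnth c 4)].

Lemma recursive_step3 F G H : recursive F -> recursive G -> recursive H ->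
  recursive (fun r => step (F r) (G r) (H r)).
Proof.
apply: recursive3; rewrite /step /entry /digit /base.
by repeat recursive_step.
Qed.

Lemma recursive_run F G H : recursive F -> recursive G -> recursive H ->
  recursive (fun r => run (F r) (G r) (H r)).
Proof.
apply: recursive3; rewrite /run; apply: recursive_iteri;
  by repeat first [apply: recursive_step3 | recursive_step].
Qed.

Lemma recursive_valid F G H : recursive F -> recursive G -> recursive H ->
  recursiveb (fun r => valid (F r) (G r) (H r)).
Proof.
apply: (recursive3 (f := fun c j s => valid c j s)); rewrite /valid /valid_top /valid_below /digit /base.
by repeat recursive_step.
Qed.

Lemma recursive_separates F G H K L : recursive F -> recursive G ->
  recursive H -> recursive K -> recursive L ->
  recursiveb (fun r => separates (F r) (G r) (H r) (K r) (L r)).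
Proof.
move=> rF rG rH rK rL.
apply: (recursive_comp
  (F := fun r => separates (r 0) (r 1) (r 2) (r 3) (r 4))
  (G := fun i => nth F [:: F; G; H; K; L] i)); last first.
  by move=> [|[|[|[|[|i]]]]] //=; rewrite nth_nil.
rewrite /separates /good_letter /respects /lhs /rhs /entry /digit /base.
by repeat first [apply: recursive_run | apply: recursive_valid
  | apply: recursive_step3 | apply: recursive_flip | recursive_step].
Qed.

(** * Soundness of certificates *)

Section Soundness.
Variable c : nat.
Local Notation B := (base c).

Lemma base_gt0 i : 0 < B ^ i. Proof. by rewrite expn_gt0. Qed.

Lemma digit_mod s s' i J : s = s' %[mod B ^ J] -> i < J ->
  digit c s i = digit c s' i.
Proof.
move=> ess ltiJ; rewrite /digit !modn_divl -expnS; congr (_ %/ _).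
by rewrite -(@modn_dvdm (B ^ J)) 1?ess ?modn_dvdm // dvdn_exp2l.
Qed.

Lemma mod_low s h J : s + B ^ J * h = s %[mod B ^ J].
Proof. by rewrite addnC mulnC modnMDl. Qed.

Definition srun w s :=
  foldl (fun t a => if t == 0 then 0 else step c a t.-1) s.+1 w.

Lemma runE w s : run c w s = srun (decode w) s.
Proof.
by rewrite /srun (foldl_nnth (fun t a => if t == 0 then 0 else step c a t.-1)).
Qed.

Lemma srun0 w :
  foldl (fun t a => if t == 0 then 0 else step c a t.-1) 0 w = 0.
Proof. by elim: w. Qed.

Lemma srun_cons a w s :
  srun (a :: w) s = if step c a s is t.+1 then srun w t else 0.
Proof.
rewrite -[LHS]/(foldl (fun t a => if t == 0 then 0 else step c a t.-1)
  (step c a s) w).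
by case: (step c a s) => //; apply: srun0.
Qed.

Lemma srun_cat w1 w2 s :
  srun (w1 ++ w2) s = if srun w1 s is t.+1 then srun w2 t else 0.
Proof. by rewrite /srun foldl_cat; case: (foldl _ _ w1) => //; apply: srun0. Qed.

Definition step_value a s := let e := entry c a s in
  (e %/ 4) %% B ^ (e %% 4) + B ^ (e %% 4) * (s %/ B ^ 2).

Lemma stepE a s : step c a s = if entry c a s %% 4 == 0 then 0 else (step_value a s).+1.
Proof. by []. Qed.

Lemma entry_mod a s s' J : s = s' %[mod B ^ J] -> 1 < J ->
  entry c a s = entry c a s'.
Proof.
by move=> ess J1; rewrite /entry !(digit_mod ess) // ltnW.
Qed.

Lemma step_value_low a s h J : 1 < J ->
  step_value a (s + B ^ J * h) = step_value a s + B ^ (entry c a s %% 4 + (J - 2)) * h.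
Proof.
move=> J1; rewrite /step_value (entry_mod _ (mod_low s h J) J1).
rewrite -addnA; congr (_ + _); rewrite expnD -mulnA -mulnDr; congr (_ * _).
by rewrite -{1}(subnK J1) expnD mulnAC addnC divnMDl ?base_gt0 // addnC.
Qed.

(** A letter reads two digits, so [2 * size w] known low digits fix the course of the run. It fails
    for every [h], or it carries the unread part [h] along, multiplied by a possibly different power
    of the base. *)
Lemma srun_affine w s J : 2 * size w <= J ->
  (forall h, srun w (s + B ^ J * h) = 0) \/
  exists p i, forall h, srun w (s + B ^ J * h) = (p + B ^ i * h).+1.
Proof.
elim: w s J => [|a w IHw] s J /= leJ; first by right; exists s, J.
have J1 : 1 < J by apply: leq_trans leJ; rewrite mulnS.
have leJ' : 2 * size w <= entry c a s %% 4 + (J - 2).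
  by rewrite mulnS in leJ; rewrite (leq_trans _ (leq_addl _ _)) // leq_subRL.
have E h : srun (a :: w) (s + B ^ J * h) = if entry c a s %% 4 == 0 then 0 else
    srun w (step_value a s + B ^ (entry c a s %% 4 + (J - 2)) * h).
  rewrite srun_cons stepE (entry_mod _ (mod_low s h J) J1) step_value_low //.
  by case: eqP.
have [k0|k0] := eqVneq (entry c a s %% 4) 0.
  by left=> h; rewrite E k0.
rewrite (negPf k0) in E.
by case: (IHw (step_value a s) _ leJ') => [H|[p' [i H]]]; [left => h | right; exists p', i => h];
  rewrite E H.
Qed.

Lemma srun_agree w w' s J : 2 * size w <= J -> 2 * size w' <= J ->
  srun w s = srun w' s -> srun w (s + B ^ J) = srun w' (s + B ^ J) ->
  forall h, srun w (s + B ^ J * h) = srun w' (s + B ^ J * h).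
Proof.
move=> le le' e0 e1 h.
case: (srun_affine s le) => [H|[p [i H]]];
case: (srun_affine s le') => [H'|[p' [i' H']]].
- by rewrite H H'.
- by move: e0 (H 0) (H' 0); rewrite muln0 addn0 => -> ->.
- by move: e0 (H 0) (H' 0); rewrite muln0 addn0 => -> ->.
- move: (H 0) (H' 0) (H 1) (H' 1).
  rewrite !muln0 !addn0 !muln1 e0 e1 => -> [] <- -> [] /addnI eB.
  by rewrite H H' eB -[p](_ : p' = p) //; move: (H 0) (H' 0);
    rewrite !muln0 !addn0 e0 => -> [].
Qed.

Lemma valid_mod s s' j J : s = s' %[mod B ^ J] -> j.+1 < J ->
  valid c j s = valid c j s'.
Proof.
move=> ess ltjJ; rewrite /valid /valid_top !(digit_mod ess) //; last 2 first.
- exact: leq_ltn_trans ltjJ.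
- exact: leq_ltn_trans ltjJ.
congr (_ && _); apply/allbP/allbP => H i ltij; have := H i ltij;
  by rewrite /valid_below !(digit_mod ess) //; apply: leq_trans ltjJ => //;
    rewrite ltnS // ltnW.
Qed.

Definition allvalid s := valid_top c s && `[< forall i, valid_below c s i >].

Lemma allvalidP s : reflect (forall j, valid c j s) (allvalid s).
Proof.
apply: (iffP andP) => [[ts /asboolP bs] j | vs].
  by rewrite /valid ts; apply/allbP => i _; apply: bs.
split; first by have /andP[] := vs 0.
by apply/asboolP => i; have /andP[_ /allbP] := vs i.+1; apply.
Qed.

Lemma mod_range s J : s %% B ^ J < 2 * B ^ J /\ s %% B ^ J + B ^ J < 2 * B ^ J.
Proof.
have lt : s %% B ^ J < B ^ J by rewrite ltn_mod base_gt0.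
by split; rewrite mul2n -addnn ?ltn_add2r // (leq_trans lt) // leq_addr.
Qed.

Lemma mod_eq2 s J : s %% B ^ J = s %[mod B ^ J] /\
  s %% B ^ J + B ^ J = s %[mod B ^ J].
Proof. by rewrite modn_mod modnDr modn_mod. Qed.

Lemma respectsP l r s : respects c l r -> allvalid s -> run c l s = run c r s.
Proof.
rewrite /respects; set j := 2 * _ => /allbP H /allvalidP vs.
have [lt0 lt1] := mod_range s j.+2; have [e0 e1] := mod_eq2 s j.+2.
have agree x : x = s %[mod B ^ j.+2] -> x < 2 * B ^ j.+2 -> run c l x = run c r x.
  by move=> ex ltx; apply/eqP/(implyP (H x ltx)); rewrite (valid_mod ex).
rewrite !runE (divn_eq s (B ^ j.+2)) addnC mulnC.
apply: srun_agree; rewrite -?runE; try exact: agree.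
- by rewrite (leq_trans _ (leq_addl 2 j)) // leq_mul2l leq_addr.
- by rewrite (leq_trans _ (leq_addl 2 j)) // leq_mul2l leq_addl.
Qed.

Lemma good_letter_inv a s t : good_letter c a -> allvalid s ->
  step c a s = t.+1 -> step c (flip a) t = s.+1.
Proof.
move=> /allbP H /allvalidP vs; rewrite stepE.
case: eqP => // /eqP k0 [et].
have [lt0 lt1] := mod_range s 6; have [e0 e1] := mod_eq2 s 6.
have agree x : x = s %[mod B ^ 6] -> x < 2 * B ^ 6 ->
    srun [:: a; flip a] x = srun [::] x.
  move=> ex ltx; have := H x ltx.
  rewrite (valid_mod ex) // vs stepE (entry_mod _ ex) // (negPf k0) /=.
  case/andP=> /eqP H1 _.
  by rewrite srun_cons stepE (entry_mod _ ex) // (negPf k0) srun_cons H1.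
have := @srun_agree [:: a; flip a] [::] (s %% B ^ 6) 6 isT isT
  (agree _ e0 lt0) (agree _ e1 lt1) (s %/ B ^ 6).
rewrite addnC mulnC -divn_eq srun_cons stepE (negPf k0) et srun_cons.
by case: step.
Qed.

Lemma good_letter_valid a s t : good_letter c a -> allvalid s ->
  step c a s = t.+1 -> allvalid t.
Proof.
move=> /allbP H vs; have /andP[_ /asboolP bs] := vs.
move/allvalidP: vs => vs; rewrite stepE.
case: eqP => // /eqP k0 [et].
have [lt0 lt1] := mod_range s 6; have [e0 e1] := mod_eq2 s 6.
have := H _ lt0; rewrite (valid_mod e0) // vs stepE (entry_mod _ e0) // (negPf k0) /=.
set x := s %% B ^ 6; set k := _ %% 4 in k0 *.
have es : s = x + B ^ 6 * (s %/ B ^ 6).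
  by rewrite {1}(divn_eq s (B ^ 6)) addnC mulnC.
case/andP=> _; have -> : valid c k.-1 (step_value a x) = valid c k.-1 t.
  apply: (@valid_mod _ _ _ (k + 4)).
    rewrite -et es step_value_low // (entry_mod _ e0) // -/k; exact/esym/mod_low.
  by rewrite prednK ?lt0n // addnS ltnS leq_addr.
case/andP=> top /allbP below.
rewrite /allvalid top; apply/asboolP => i.
have [ltik|leki] := ltnP i k.-1; first exact: below.
(* The unread digits move from position 2 to position [k], so adjacencies from [k - 1] on are
   inherited from [s]. *)
have shift j : digit c t (k + j) = digit c s j.+2.
  have tk : t %/ B ^ k = s %/ B ^ 2.
    rewrite -et /step_value -/k (addnC (_ %% _)) (mulnC (B ^ k)) divnMDl ?base_gt0 //.
    by rewrite (@divn_small (_ %% _)) ?ltn_mod ?base_gt0 // addn0.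
  by rewrite /digit expnD divnMA tk -divnMA -expnD.
have lek : k <= i.+1 by rewrite -(prednK (n := k)) ?lt0n.
rewrite /valid_below -(subnKC lek) -addnS !shift; exact: bs.
Qed.

Variable P : presentation.
Hypothesis letters_good : forall a, a < 2 * ngens P -> good_letter c a.
Hypothesis relators_good : forall i, i < size (relators P) ->
  respects c (lhs (code_relators P) i) (rhs (code_relators P) i).

Definition wrun (w : word (ngens P)) s := srun (map (@code_letter _) w) s.

Lemma wrun_code w s : wrun w s = run c (code_word w) s.
Proof. by rewrite runE /code_word CodeSeq.codeK. Qed.

Lemma wrun_cat u v s :
  wrun (u ++ v) s = if wrun u s is t.+1 then wrun v t else 0.
Proof. by rewrite /wrun map_cat srun_cat. Qed.

Lemma wrun_inv w s t : allvalid s -> wrun w s = t.+1 ->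
  allvalid t /\ wrun (inv_word w) t = s.+1.
Proof.
elim: w s => [|a w IHw] s vs; first by move=> [<-].
rewrite /wrun /= srun_cons; case es: step => [//|s1] e1.
have ga : good_letter c (code_letter a).
  apply: letters_good; case: a {es} => i b; rewrite /code_letter /= mul2n.
  by rewrite -ltn_half_double addnC half_bit_double.
have [vt et] := IHw s1 (good_letter_valid ga vs es) e1.
split=> //; rewrite -/(wrun _ _) /inv_word /= rev_cons -cats1 wrun_cat et.
by rewrite /wrun /= srun_cons flip_code_letter (good_letter_inv ga vs es).
Qed.

Lemma wrun_idem w s : allvalid s ->
  wrun (w ++ inv_word w) s = if wrun w s is t.+1 then s.+1 else 0.
Proof.
by move=> vs; rewrite wrun_cat; case e: wrun => [//|t]; have [] := wrun_inv vs e.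
Qed.

(** On valid stacks a word followed by its inverse acts as a partial identity; partial identities
    commute, which gives the inverse monoid axioms. *)
Lemma tau_wrun u v : tau u v -> forall s, allvalid s -> wrun u s = wrun v s.
Proof.
elim=> {u v} [u v uv | u | u v | u | u v _ IH | v u w _ IH1 _ IH2
             | u u' v v' _ IH1 _ IH2] s vs //.
- rewrite !wrun_code; have lt : index (u, v) (relators P) < size (relators P).
    by rewrite index_mem.
  have := respectsP (relators_good lt) vs.
  by have [-> ->] := lhs_relators lt; rewrite nth_index.
- rewrite catA wrun_cat wrun_idem //.
  by case e: (wrun u s).
- rewrite (catA u (inv_word u)) (catA v (inv_word v)).
  rewrite (wrun_cat (u ++ _)) (wrun_cat (v ++ _)) !wrun_idem //.
  by case eu: (wrun u s) => [|t]; case ev: (wrun v s) => [|t'];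
    rewrite ?wrun_idem ?eu ?ev.
- by rewrite IH.
- by rewrite IH1 ?IH2.
- rewrite !wrun_cat IH1 //; case e: (wrun u' s) => [//|t].
  by apply: IH2; case: (wrun_inv vs e).
Qed.

End Soundness.

Lemma separates_sound P (u v : word (ngens P)) c :
  separates (ngens P) (code_relators P) (code_word u) (code_word v) c ->
  ~ tau u v.
Proof.
case/and5P=> /allbP gl /allbP gr va b0 /negP neq uv; case: neq.
rewrite -!wrun_code; apply/eqP/(tau_wrun gl _ uv).
  by move=> i lti; apply: gr; rewrite size_relators.
case/andP: va => top /allbP below; rewrite /allvalid top; apply/asboolP => i.
have [lti|lei] := ltnP i (nnth c 4); first exact: below.
have dz j : nnth c 4 <= j -> digit c (nnth c 4) j = 0.
  move=> lej; rewrite /digit divn_small ?mod0n // (leq_ltn_trans lej) //.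
  exact: ltn_expl.
by rewrite /valid_below !dz // (leq_trans lei) // ltnW.
Qed.

(** * Bags of a tree partition *)

Definition acts n (V : Type) (act : 'I_n * bool -> V -> option V) :=
  fun (w : word n) (x : V) => foldl (fun o a => obind (act a) o) (Some x) w.

Section Words.
Variables (n : nat) (V : Type) (act : 'I_n * bool -> V -> option V).

Lemma acts_rcons w a x : acts act (rcons w a) x = obind (act a) (acts act w x).
Proof. by rewrite /acts -cats1 foldl_cat. Qed.

Lemma acts_cons a w x : acts act (a :: w) x = obind (acts act w) (act a x).
Proof. by rewrite /acts /=; case: (act a x) => //=; elim: w. Qed.

End Words.

Section Regularization.
Variables (n : nat) (V C : eqType) (act : 'I_n * bool -> V -> option V).
Variables (p : V -> seq C) (G : nat).
Implicit Types (c : seq C) (x y : V).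

(* Nodes of the tree are nonempty sequences, [behead] being the parent map; the *)
(* bag of [c] is the part of the graph lying at most two levels below [c].      *)
Definition bag c y := exists2 l, p y = l ++ c & size l <= 2.

Hypothesis conn : forall c y y', bag c y -> bag c y' ->
  exists2 w, size w <= G & acts act w y = Some y'.

Record bag_iso c c' (phi psi : V -> V) : Prop := BagIso {
  iso_bag : forall y, bag c y -> bag c' (phi y);
  iso_bagV : forall y, bag c' y -> bag c (psi y);
  iso_K : forall y, bag c y -> psi (phi y) = y;
  iso_Kd : forall y, bag c' y -> phi (psi y) = y;
  iso_level : forall y, bag c y ->
    size (p (phi y)) + size c = size (p y) + size c';
  iso_act : forall a y y', bag c y -> bag c y' ->
    act a y = Some y' <-> act a (phi y) = Some (phi y') }.

Let W := {bseq G of 'I_n * bool}.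

(** From a base point, words of length at most [G] name all vertices of a bag. The type records, for
    these finitely many names, which are in use, their levels, coincidences and edges; matching
    names is then an isomorphism. Recording whether [c] is empty keeps the root apart. *)
Lemma bag_types : exists (types : finType) (ty : seq C -> types),
  forall c c', ty c = ty c' ->
    (c == [::]) = (c' == [::]) /\ exists phi psi, bag_iso c c' phi psi.
Proof.
have /choice[bp bpP] : forall c, exists o : option V,
    if o is Some x then bag c x else forall y, ~ bag c y.
  move=> c; have [[x cx]|nc] := pselect (exists x, bag c x); first by exists (Some x).
  by exists None => y cy; apply: nc; exists y.
(* The walk [w] may leave the bag, provided that it ends inside. *)
pose pt c (w : W) := if obind (acts act w) (bp c) is Some y then
  if `[< bag c y >] then Some y else None else None.
have ptP c w y : pt c w = Some y -> bag c y.
  by rewrite /pt; case: obind => // z; case: ifP => // /asboolP cz [<-].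
have ptE c y : bag c y -> exists w, pt c w = Some y.
  move=> cy; have := bpP c; rewrite /pt; case: (bp c) => [x cx|/(_ _ cy) //].
  have [w ltw ew] := conn cx cy; exists (Bseq ltw) => /=; rewrite ew.
  by case: asboolP.
pose lev c (w : W) : 'I_3 := if pt c w is Some y then inord (size (p y) - size c)
                             else ord0.
have levE c w y : pt c w = Some y -> size (p y) = lev c w + size c.
  move=> e; rewrite /lev e; have [l -> lel] := ptP _ _ _ e.
  by rewrite size_cat addnK inordK.
pose ty c := ((c == [::], finfun (lev c)), ([ffun w => pt c w == None],
  [ffun ww : W * W => pt c ww.1 == pt c ww.2],
  [ffun aww : ('I_n * bool) * (W * W) =>
     obind (act aww.1) (pt c aww.2.1) == pt c aww.2.2])).
exists _, ty => c c' [enil] /ffunP elev /ffunP edef /ffunP eeq /ffunP eact.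
split=> //.
have def w y : pt c w = Some y -> exists y', pt c' w = Some y'.
  by move=> e; have := edef w; rewrite !ffunE e; case: (pt c' w) => // y'; exists y'.
have defV w y : pt c' w = Some y -> exists y', pt c w = Some y'.
  by move=> e; have := edef w; rewrite !ffunE e; case: (pt c w) => // y'; exists y'.
have det w1 w2 : (pt c w1 == pt c w2) = (pt c' w1 == pt c' w2).
  by have := eeq (w1, w2); rewrite !ffunE.
have /choice[phi phiP] : forall y, exists y', bag c y ->
    exists2 w, pt c w = Some y & pt c' w = Some y'.
  move=> y;
  have [/ptE[w ew]|ncy] := pselect (bag c y); last by exists y.
  by have [y' ew'] := def _ _ ew; exists y' => _; exists w.
have /choice[psi psiP] : forall y, exists y', bag c' y ->
    exists2 w, pt c' w = Some y & pt c w = Some y'.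
  move=> y;
  have [/ptE[w ew]|ncy] := pselect (bag c' y); last by exists y.
  by have [y' ew'] := defV _ _ ew; exists y' => _; exists w.
have phiE w y : pt c w = Some y -> pt c' w = Some (phi y).
  move=> e; have [w' e1 <-] := phiP _ (ptP _ _ _ e).
  by apply/eqP; rewrite -det e e1.
have psiE w y : pt c' w = Some y -> pt c w = Some (psi y).
  move=> e; have [w' e1 <-] := psiP _ (ptP _ _ _ e).
  by apply/eqP; rewrite det e e1.
exists phi, psi; split.
- by move=> y /ptE[w /phiE/ptP].
- by move=> y /ptE[w /psiE/ptP].
- by move=> y /ptE[w e]; have := psiE _ _ (phiE _ _ e); rewrite e => -[].
- by move=> y /ptE[w e]; have := phiE _ _ (psiE _ _ e); rewrite e => -[].
- move=> y /ptE[w e]; rewrite (levE _ _ _ e) (levE _ _ _ (phiE _ _ e)).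
  by have := elev w; rewrite !ffunE => ->; rewrite addnAC.
- move=> a y y' /ptE[w e] /ptE[w' e'].
  have := eact (a, (w, w')); rewrite !ffunE /= e e' (phiE _ _ e) (phiE _ _ e') /=.
  by move=> E; split=> /eqP e1; apply/eqP; [rewrite -E | rewrite E].
Qed.

Lemma bag_finite c : exists l : seq V, forall y, bag c y -> y \in l.
Proof.
have [[x cx]|nc] := pselect (exists x, bag c x); last first.
  by exists [::] => y cy; case: nc; exists y.
exists (pmap (fun w : W => acts act w x) (enum {: W})) => y cy.
have [w ltw ew] := conn cx cy.
rewrite mem_pmap; apply/mapP; exists (Bseq ltw); first by rewrite mem_enum.
by rewrite ew.
Qed.

(** [ret c] is the representative of the type of [c], and [U] gathers the finitely many
    representative bags, each of them finite. *)
Lemma regularization :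
  exists (ret : seq C -> seq C) (phi psi : seq C -> V -> V) (U : seq V),
  [/\ ret [::] = [::], forall c, bag_iso c (ret c) (phi c) (psi c)
    & forall c y, behead (p y) = ret c -> p y != [::] -> y \in U].
Proof.
have [types [ty tyP]] := bag_types.
have /choice[rep repP'] t : exists c, (exists c', ty c' = t) -> ty c = t.
  have [[c e]|nt] := pselect (exists c, ty c = t); first by exists c.
  by exists [::] => /nt.
have repP c : ty (rep (ty c)) = ty c by apply: repP'; exists c.
pose ret c := rep (ty c).
have /choice[ff ffP] c : exists f : (V -> V) * (V -> V), bag_iso c (ret c) f.1 f.2.
  have [_ [phi [psi iso]]] := tyP c (ret c) (esym (repP c)).
  by exists (phi, psi).
have /fin_all_exists[ls lsP] (t : types) := bag_finite (rep t).
exists ret, (fun c => (ff c).1), (fun c => (ff c).2), (flatten (codom ls)).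
split=> // [|c y ey py].
  by have [+ _] := tyP _ _ (repP [::]); rewrite eqxx => /eqP.
apply/flattenP; exists (ls (ty c)); first exact: codom_f.
apply: lsP; exists (take 1 (p y)); last by rewrite size_take; case: (p y) => [|? []].
by rewrite -/(ret c) -ey; case: (p y) => //= a s; rewrite take0.
Qed.

End Regularization.

(** * The certificate of a tree partition *)

(** With [behead] as parent map: equal nodes, parent and child, or siblings. *)
Definition close (T : Type) (q q' : seq T) : Prop :=
  exists m l l', [/\ q = l ++ m, q' = l' ++ m, size l <= 1 & size l' <= 1].

Lemma close_up T (q q' : seq T) : close q q' -> size q' = (size q).+1 ->
  behead q' = q.
Proof.
move=> [m [l [l' [-> ->]]]]; case: l' => [|b [|//]] /=; case: l => [|a [|//]] //=; lia.
Qed.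

Lemma close_size T (q q' : seq T) : close q q' -> size q' <= (size q).+1.
Proof.
move=> [m [l [l' [-> -> _ le']]]]; rewrite !size_cat.
by rewrite (leq_trans (n := 1 + size m)) ?leq_add2r // add1n ltnS leq_addl.
Qed.

Lemma nnth_mkseq f k i : i < k -> nnth (code (mkseq f k)) i = f i.
Proof. by move=> lt; rewrite /nnth CodeSeq.codeK nth_mkseq. Qed.

Lemma horner2 b x y r : x + b * y + b ^ 2 * r = x + b * (y + b * r).
Proof. by rewrite mulnDr addnA (expnS b 1) expn1 !mulnA. Qed.

Lemma horner3 b x y z r :
  x + b * (y + b * z) + b ^ 3 * r = x + b * (y + b * (z + b * r)).
Proof. by rewrite !mulnDr !addnA (expnS b 2) (expnS b 1) expn1 !mulnA. Qed.

Section Certificate.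
Variables (n : nat) (V C : eqType) (act : 'I_n * bool -> V -> option V).
Variables (p : V -> seq C) (N : nat).
Variables (ret : seq C -> seq C) (phi psi : seq C -> V -> V) (U : seq V) (o : V).

Hypothesis act_inv : forall a x y, act a x = Some y -> act (inv_letter a) y = Some x.
Hypothesis p_neq0 : forall y, p y != [::].
Hypothesis near : forall w x y, size w <= N -> acts act w x = Some y ->
  close (p x) (p y).
Hypothesis N_gt1 : 1 < N.
Hypothesis ret0 : ret [::] = [::].
Hypothesis iso : forall c, bag_iso act p c (ret c) (phi c) (psi c).
Hypothesis U_uniq : uniq U.
Hypothesis U_mem : forall c y, behead (p y) = ret c -> y \in U.

Let Q := [::] :: undup (map p U).
Let c0 := size U + size Q.
Let B := c0.+2.

Lemma ltU v : index v U < B.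
Proof. by rewrite (leq_ltn_trans (index_size _ _)) // ltnS ltnW // ltnS leq_addr. Qed.
Definition node z := index z Q.
Lemma ltQ z : node z < B.
Proof. by rewrite /node (leq_ltn_trans (index_size _ _)) // ltnS ltnW // ltnS leq_addl. Qed.

(* The cases move to the parent (pop), within a level, and to a child (push).  *)
Definition transition a v z := if act a v is Some y then
  if p y == ret z then 1 + 4 * index (psi z y) U
  else if behead (p y) == ret z then 2 + 4 * (index y U + B * node z)
  else 3 + 4 * (index (phi (p v) y) U + B * (node (p v) + B * node z))
  else 0.

Definition table i := if decode_letter n (i %/ B %/ B) is Some a then
  transition a (nth o U (i %/ B %% B)) (nth [::] Q (i %% B)) else 0.
Definition adj_top i := (i %/ B < size U) && (i %% B < size Q) &&
  (behead (p (nth o U (i %/ B))) == ret (nth [::] Q (i %% B))) : nat.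
Definition adj_below i := (i %/ B < size Q) && (i %% B < size Q) &&
  (behead (nth [::] Q (i %/ B)) == ret (nth [::] Q (i %% B))) : nat.

Definition cert := code [:: c0; code (mkseq table (2 * n * B * B));
  code (mkseq adj_top (B * B)); code (mkseq adj_below (B * B)); index o U].

Lemma certE i : nnth cert i = nth 0 [:: c0; code (mkseq table (2 * n * B * B));
  code (mkseq adj_top (B * B)); code (mkseq adj_below (B * B)); index o U] i.
Proof. by rewrite /nnth CodeSeq.codeK. Qed.

Lemma cert1 : nnth cert 1 = code (mkseq table (2 * n * B * B)).
Proof. by rewrite certE. Qed.
Lemma cert2 : nnth cert 2 = code (mkseq adj_top (B * B)).
Proof. by rewrite certE. Qed.
Lemma cert3 : nnth cert 3 = code (mkseq adj_below (B * B)).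
Proof. by rewrite certE. Qed.
Lemma cert4 : nnth cert 4 = index o U.
Proof. by rewrite certE. Qed.

Lemma base_cert : base cert = B. Proof. by rewrite /base certE. Qed.

Lemma pair_div x y : y < B -> (x * B + y) %/ B = x.
Proof. by move=> lt; rewrite divnMDl // divn_small ?addn0. Qed.
Lemma pair_mod x y : y < B -> (x * B + y) %% B = y.
Proof. by move=> lt; rewrite modnMDl modn_small. Qed.
Lemma pair_lt k x y : x < k -> y < B -> x * B + y < k * B.
Proof.
move=> ltx lty; apply: (@leq_trans (x.+1 * B)); last by rewrite leq_mul2r ltx orbT.
by rewrite mulSn addnC ltn_add2r.
Qed.

(** In a valid configuration [v] lies one level below [ret z], in a copy of the representative bag
    glued in place of the bag of [z]; [phi z] and [psi z] translate between the two. *)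
Definition conf v z r := index v U + B * (node z + B * r).

Lemma lt_digit s i : digit cert s i < B.
Proof. by rewrite /digit base_cert ltn_mod. Qed.

Lemma digit_conf0 v z r : digit cert (conf v z r) 0 = index v U.
Proof.
by rewrite /digit base_cert expn0 divn1 /conf addnC mulnC pair_mod ?ltU.
Qed.
Lemma conf_div v z r : conf v z r %/ B = node z + B * r.
Proof. by rewrite /conf addnC mulnC pair_div ?ltU. Qed.
Lemma digit_conf1 v z r : digit cert (conf v z r) 1 = node z.
Proof.
by rewrite /digit base_cert expn1 conf_div addnC mulnC pair_mod ?ltQ.
Qed.
Lemma conf_div2 v z r : conf v z r %/ B ^ 2 = r.
Proof. by rewrite divnMA conf_div addnC mulnC pair_div ?ltQ. Qed.
Lemma digit_conf2 v z r i : digit cert (conf v z r) i.+2 = digit cert r i.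
Proof. by rewrite /digit base_cert (expnD B 2) divnMA conf_div2. Qed.

Lemma Q_uniq : uniq Q.
Proof.
rewrite /= undup_uniq andbT mem_undup; apply/mapP => -[y _ e].
by have := p_neq0 y; rewrite -e.
Qed.

Lemma Q_mem y : y \in U -> p y \in Q.
Proof. by move=> yU; rewrite inE mem_undup map_f ?orbT. Qed.

Lemma Q_mem0 : [::] \in Q. Proof. by rewrite inE eqxx. Qed.

Lemma valid_top_conf v z r : v \in U -> z \in Q ->
  valid_top cert (conf v z r) = (behead (p v) == ret z).
Proof.
move=> vU zQ; rewrite /valid_top base_cert cert2 nnth_mkseq ?pair_lt ?lt_digit //.
rewrite /adj_top pair_div ?pair_mod ?lt_digit // digit_conf0 digit_conf1.
by rewrite /node !index_mem vU zQ !nth_index // eqb0 negbK.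
Qed.

Lemma valid_topE s : valid_top cert s -> exists v z,
  [/\ v \in U, z \in Q, behead (p v) = ret z & s = conf v z (s %/ B ^ 2)].
Proof.
rewrite /valid_top base_cert cert2 nnth_mkseq ?pair_lt ?lt_digit //.
rewrite /adj_top pair_div ?pair_mod ?lt_digit // eqb0 negbK -andbA.
case/and3P => lt0 lt1 /eqP e.
exists (nth o U (digit cert s 0)), (nth [::] Q (digit cert s 1)).
split; rewrite ?mem_nth // /conf /node !index_uniq ?Q_uniq // /digit base_cert.
rewrite expn0 expn1 divn1 addnC mulnC [s in LHS](divn_eq s B); congr (_ * _ + _).
by rewrite addnC mulnC {1}(divn_eq (s %/ B) B) -divnMA.
Qed.

Definition on_node z r := exists2 z2, z2 \in Q & behead z = ret z2 /\
  exists r2, r = node z2 + B * r2.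

Lemma valid_below0 v z r : z \in Q -> valid_below cert (conf v z r) 0 ->
  on_node z r.
Proof.
move=> zQ; rewrite /valid_below base_cert cert3 nnth_mkseq ?pair_lt ?lt_digit //.
rewrite /adj_below pair_div ?pair_mod ?lt_digit // digit_conf1 digit_conf2.
rewrite /node index_mem zQ nth_index // eqb0 negbK /= => /andP[lt /eqP e].
exists (nth [::] Q (digit cert r 0)); rewrite ?mem_nth //; split=> //.
exists (r %/ B); rewrite /node index_uniq ?Q_uniq // /digit base_cert divn1.
by rewrite {1}(divn_eq r B) addnC mulnC.
Qed.

Lemma below_pair s i z z2 : digit cert s i.+1 = node z ->
  digit cert s i.+2 = node z2 -> z \in Q -> z2 \in Q -> behead z = ret z2 ->
  valid_below cert s i.
Proof.
move=> e1 e2 zQ zQ2 e.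
rewrite /valid_below base_cert cert3 nnth_mkseq ?pair_lt ?lt_digit //.
rewrite /adj_below pair_div ?pair_mod ?lt_digit // e1 e2 /node !index_mem zQ zQ2.
by rewrite !nth_index // e eqxx.
Qed.

Lemma code_letter_lt (a : 'I_n * bool) : code_letter a < 2 * n.
Proof. by case: a => i b; rewrite /code_letter /=; have := ltn_ord i; case: b; lia. Qed.

Lemma entry_conf a v z r : v \in U -> z \in Q ->
  entry cert (code_letter a) (conf v z r) = transition a v z.
Proof.
move=> vU zQ; rewrite /entry base_cert digit_conf0 digit_conf1 cert1.
rewrite nnth_mkseq; last by rewrite !pair_lt ?ltU ?ltQ ?code_letter_lt.
rewrite /table !pair_div ?pair_mod ?ltU ?ltQ //.
by rewrite /node code_letterK !nth_index.
Qed.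

Lemma step_conf a v z r : v \in U -> z \in Q ->
  step cert (code_letter a) (conf v z r) = if act a v is Some y then
    if p y == ret z then (index (psi z y) U + B * r).+1
    else if behead (p y) == ret z then (conf y z r).+1
    else (conf (phi (p v) y) (p v) (node z + B * r)).+1
  else 0.
Proof.
move=> vU zQ; rewrite /step entry_conf // base_cert conf_div2 /transition; cbv zeta.
case: (act a v) => [y|] //.
have out k m : 0 < k < 4 -> m < B ^ k ->
    (if (k + 4 * m) %% 4 == 0 then 0 else
     ((k + 4 * m) %/ 4 %% B ^ ((k + 4 * m) %% 4) +
      B ^ ((k + 4 * m) %% 4) * r).+1) = (m + B ^ k * r).+1.
  move=> k4 ltm; have -> : (k + 4 * m) %% 4 = k by lia.
  have -> : (k + 4 * m) %/ 4 = m by lia.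
  by rewrite modn_small // ifN //; lia.
have lt2 x y1 : x < B -> y1 < B -> x + B * y1 < B ^ 2.
  by move=> ltx lty; rewrite addnC mulnC; apply: pair_lt.
case: (p y == ret z); last case: (behead (p y) == ret z); rewrite out //.
- by rewrite expn1 ltU.
- by rewrite horner2.
- by rewrite lt2 ?ltU ?ltQ.
- by rewrite horner3.
- by rewrite addnC mulnC (expnSr B 2); apply: (@pair_lt (B ^ 2)); rewrite ?ltU // lt2 ?ltQ.
Qed.

Arguments node : simpl never.

(** Closeness permits one level up, then one level down, from level one of the bag; this ends at
    levels zero to two. *)
Lemma bag_near w s v y : behead (p v) = s -> size w <= N ->
  acts act w v = Some y -> bag p s y.
Proof.
move=> es lew /(near lew)[m [l [l' [ev ey le le']]]]; rewrite /bag ey.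
move: ev es (p_neq0 v); case: (p v) => // a q + /= eq _; rewrite {q}eq.
case: l le => [|b [|//]] _ /= => [<-|[_ ->]]; last by exists l' => //; apply: leqW.
by exists (rcons l' a); rewrite ?cat_rcons ?size_rcons.
Qed.

Lemma phi_level s y l : p y = l ++ s -> size l <= 2 ->
  exists2 l', p (phi s y) = l' ++ ret s & size l' = size l.
Proof.
move=> ey le; have sy : bag p s y by exists l.
have [l' e' _] := iso_bag (iso s) sy; exists l' => //.
by have := iso_level (iso s) sy; rewrite ey e' !size_cat; lia.
Qed.

Lemma phi_behead s y : behead (p y) = s -> behead (p (phi s y)) = ret s.
Proof.
have := p_neq0 y; case ey: (p y) => [//|a q] _ /= eq; rewrite {q}eq in ey.
by have [[|b [|//]] -> //=] := @phi_level s y [:: a] ey isT.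
Qed.

(* A path that leaves the bag would not be short: this lets bag isomorphisms   *)
(* transport undefined actions too.                                            *)
Lemma phi_acts s u w : behead (p u) = s -> size w <= N ->
  acts act w (phi s u) = omap (phi s) (acts act w u).
Proof.
move=> eu; elim/last_ind: w => [//|w a IHw] lew.
have lew' : size w <= N by rewrite size_rcons in lew; apply: ltnW.
have bagN := bag_near eu lew; have bagN' := bag_near (phi_behead eu) lew.
move: bagN bagN'; rewrite !acts_rcons IHw //.
case ew: (acts act w u) => [y|] //= bagN bagN'.
have sy := bag_near eu lew' ew.
case ea: (act a y) => [y'|] /=.
  by apply/(iso_act (iso s) a sy (bagN _ ea)).
case eb: (act a (phi s y)) => [y1|] //; have sy1 := bagN' _ eb.
have := (iso_act (iso s) a sy (iso_bagV (iso s) sy1)).2.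
by rewrite (iso_Kd (iso s)) // ea => /(_ eb).
Qed.

(* The embedding of the bag of [ret z] into the new graph, at node [z] of the  *)
(* stack [r].                                                                  *)
Definition iota z r y := if p y == ret z then index (psi z y) U + B * r
  else if behead (p y) == ret z then conf y z r
  else conf (phi (behead (p y)) y) (behead (p y)) (node z + B * r).

Lemma acts1 a y : acts act [:: a] y = act a y.
Proof. by []. Qed.

Lemma bag_size s y : bag p s y -> size (p y) <= (size s).+2.
Proof. by move=> [l -> le]; rewrite size_cat -add2n leq_add2r. Qed.

Lemma bag_eq s y : bag p s y -> size (p y) <= size s -> p y = s.
Proof.
move=> [l -> _]; rewrite size_cat -[X in _ <= X]add0n leq_add2r leqn0.
by move/nilP->.
Qed.

Lemma bag_behead s y : bag p s y -> size (p y) = (size s).+1 -> behead (p y) = s.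
Proof.
move=> [l -> _]; rewrite size_cat -add1n => /addIn.
by case: l => // a [].
Qed.

Lemma bag_gt s y : bag p s y -> size s <= size (p y).
Proof. by move=> [l -> _]; rewrite size_cat leq_addl. Qed.

Lemma bag_level2 s y : bag p s y -> p y != s -> behead (p y) != s ->
  size (p y) = (size s).+2.
Proof.
move=> sy n0 n1; have := bag_gt sy; have := bag_size sy.
have : size (p y) <> size s by move=> e; case/eqP: n0; apply: bag_eq; rewrite ?e.
have : size (p y) <> (size s).+1 by move=> /(bag_behead sy)/eqP; rewrite (negPf n1).
lia.
Qed.

Lemma size_neq (s t : seq C) : size s <> size t -> (s == t) = false.
Proof. by move=> n_st; apply/eqP => e; apply: n_st; rewrite e. Qed.

Lemma srun1 a s : srun cert [:: a] s = step cert a s.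
Proof. by rewrite srun_cons; case: (step cert a s). Qed.

(** Faithful simulation of short walks. The last letter is treated according to the level, in the
    bag of [ret z], of the vertex reached before it. *)
Lemma run_conf z r v w : v \in U -> z \in Q -> behead (p v) = ret z ->
  on_node z r -> size w <= N ->
  srun cert (map (@code_letter n) w) (conf v z r) =
    if acts act w v is Some y then (iota z r y).+1 else 0.
Proof.
move=> vU zQ ev [z2 z2Q [ez2 [r2 er]]].
have size_pv : size (p v) = (size (ret z)).+1.
  by rewrite -ev; case: (p v) (p_neq0 v).
elim/last_ind: w => [_|w a IHw lew].
  by rewrite /srun /= /iota ev eqxx size_neq //; lia.
have N1 : size [:: a] <= N by apply: ltnW.
have lew' : size w <= N by rewrite size_rcons in lew; apply: ltnW.
have bagN y : acts act (rcons w a) v = Some y -> bag p (ret z) y.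
  exact: bag_near.
rewrite map_rcons -cats1 srun_cat IHw //; move: bagN; rewrite acts_rcons.
case ew: (acts act w v) => [y|] //= bagN; rewrite srun1.
have near_vy := near lew' ew; have sy := bag_near ev lew' ew.
have near_y y1 : act a y = Some y1 -> close (p y) (p y1).
  by rewrite -acts1; apply: near N1.
rewrite [in LHS]/iota; case: eqP => [py|/eqP nlev0]; last first.
  case: eqP => [py|/eqP nlev1].
    have yU : y \in U by apply: U_mem py.
    rewrite step_conf //; case ea: (act a y) => [y1|] //.
    rewrite /iota; case: eqP => // /eqP n0; case: eqP => // /eqP n1.
    suff -> : p y = behead (p y1) by [].
    apply/esym/close_up; first exact: near_y.
    by rewrite (bag_level2 (bagN _ ea) n0 n1) -py; case: (p y) (p_neq0 y).
  (* Two levels down, the configuration is based at the node [p v]; [phi (p v)] transports the next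
     letter, and its three outcomes are compared with [iota]. *)
  have size_y := bag_level2 sy nlev0 nlev1.
  have ey : behead (p y) = p v.
    by apply: close_up near_vy _; rewrite size_y size_pv.
  rewrite ey step_conf ?Q_mem //; last exact: U_mem (phi_behead ey).
  rewrite -[act a _]acts1 (phi_acts ey N1) acts1.
  case ea: (act a y) => [y1|] //=.
  have ty1 := bag_near ey N1 (etrans (acts1 _ _) ea); have sy1 := bagN _ ea.
  have lev := iso_level (iso (p v)) ty1; have le1 := bag_size sy1.
  have := bag_gt ty1; rewrite leq_eqVlt => /predU1P[e1|lt1].
    have ey1 : p y1 = p v by apply: bag_eq ty1 _; rewrite -e1.
    have -> : p (phi (p v) y1) = ret (p v).
      by apply: bag_eq (iso_bag (iso (p v)) ty1) _; lia.
    rewrite eqxx (iso_K (iso (p v))) //.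
    by rewrite /iota ey1 ev eqxx size_neq //; lia.
  have e1 : behead (p y1) = p v by apply: bag_behead ty1 _; lia.
  rewrite size_neq; last by lia.
  rewrite (phi_behead e1) eqxx /iota size_neq; last by lia.
  by rewrite e1 size_neq //; lia.
(* At the parent level, the whole walk is pulled back along [psi z] into the bag of [z]. There the
   current vertex is [v0], one level below [ret z2]; the letter acts on it and [phi z] carries the
   result back. *)
have sv : bag p (ret z) v.
  move: ev; case epv: (p v) => [|b q] /= ev; first by rewrite epv in size_pv.
  by exists [:: b]; rewrite // epv ev.
have zu := iso_bagV (iso z) sv; set u := psi z v in zu.
have phiu : phi z u = v by apply: iso_Kd (iso z) _ sv.
have eu : behead (p u) = z.
  apply: (bag_behead zu); have := iso_level (iso z) zu; rewrite phiu; lia.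
have zv0 := iso_bagV (iso z) sy; set v0 := psi z y in zv0 *.
have phiv0 : phi z v0 = y by apply: iso_Kd (iso z) _ sy.
have pv0 : p v0 = z.
  apply: (bag_eq zv0); have := iso_level (iso z) zv0; rewrite phiv0 py; lia.
have uv0 : acts act w u = Some v0.
  have := phi_acts eu lew'; rewrite phiu ew; case e: (acts act w u) => [y'|] //= [ey'].
  by rewrite /v0 ey' (iso_K (iso z)) //; apply: bag_near e.
have size_z : size z = (size (ret z2)).+1.
  by rewrite -ez2 -pv0; case: (p v0) (p_neq0 v0).
have -> : act a y = omap (phi z) (act a v0).
  by have := phi_acts eu lew; rewrite phiu !acts_rcons ew uv0.
have -> : index v0 U + B * r = conf v0 z2 r2 by rewrite er.
rewrite step_conf //; last by apply: (@U_mem z2); rewrite pv0.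
case ea: (act a v0) => [y0|] //=.
have zy0 : bag p z y0.
  by apply: (bag_near eu lew); rewrite acts_rcons uv0.
have le0 : size (p y0) <= (size z).+1.
  by rewrite -pv0; apply: close_size; apply: near N1 _; rewrite acts1 ea.
have lev := iso_level (iso z) zy0.
have := bag_gt zy0; rewrite leq_eqVlt => /predU1P[e0|lt0].
  have ey0 : p y0 = z by apply: bag_eq zy0 _; rewrite -e0.
  rewrite ey0 ez2 eqxx size_neq; last by lia.
  rewrite /iota (bag_eq (iso_bag (iso z) zy0)); last by lia.
  by rewrite eqxx (iso_K (iso z)) // er.
have e0 : behead (p y0) = z by apply: bag_behead zy0 _; lia.
rewrite size_neq; last by lia.
rewrite e0 size_neq; last by lia.
rewrite /iota size_neq; last by lia.
by rewrite (phi_behead e0) eqxx pv0 er.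
Qed.

Lemma digit_node z r : digit cert (node z + B * r) 0 = node z.
Proof.
by rewrite /digit base_cert expn0 divn1 addnC mulnC pair_mod ?ltQ.
Qed.

Lemma digit_nodeS z r i : digit cert (node z + B * r) i.+1 = digit cert r i.
Proof.
by rewrite /digit base_cert (expnD B 1) divnMA expn1 addnC mulnC pair_div ?ltQ.
Qed.

Lemma valid_conf s j : 0 < j -> valid cert j s -> exists v z r,
  [/\ v \in U, z \in Q, behead (p v) = ret z, on_node z r & s = conf v z r].
Proof.
move=> j0 /andP[/valid_topE[v [z [vU zQ e ->]]]] /allbP /(_ 0 j0) /valid_below0.
by exists v, z, (s %/ B ^ 2); split; auto.
Qed.

Lemma respects_cert (l r : word n) : size l <= N -> size r <= N ->
  (forall x, acts act l x = acts act r x) ->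
  respects cert (code_word l) (code_word r).
Proof.
move=> lel ler elr; apply/allbP => s _; apply/implyP; rewrite !runE.
rewrite /code_word /nsize !CodeSeq.codeK !size_map.
case: (posnP (2 * (size l + size r))) => [|j0 vs].
  by move/eqP; rewrite muln_eq0 addn_eq0 /= => /andP[/nilP-> /nilP->].
have [v [z [t [vU zQ ev zt ->]]]] := valid_conf j0 vs.
by rewrite !run_conf // elr.
Qed.

Lemma entry_mod4 a v z r y : v \in U -> z \in Q -> act a v = Some y ->
  entry cert (code_letter a) (conf v z r) %% 4 =
    if p y == ret z then 1 else if behead (p y) == ret z then 2 else 3.
Proof.
move=> vU zQ ea; rewrite entry_conf // /transition ea.
by case: eqP => _; last case: eqP => _; rewrite addnC mulnC modnMDl.
Qed.

Lemma iota_self z r v : behead (p v) = ret z -> iota z r v = conf v z r.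
Proof.
move=> ev; rewrite /iota ev eqxx size_neq // -ev.
by case: (p v) (p_neq0 v) => //= d q _; lia.
Qed.

Lemma good_letter_cert (a : 'I_n * bool) : good_letter cert (code_letter a).
Proof.
apply/allbP => s _; apply/implyP => /andP[vs].
have [v [z [t [vU zQ ev zt ->]]]] := valid_conf (isT : 0 < 4) vs.
have estep := step_conf a t vU zQ => step0.
case ea: (act a v) estep => [y|] estep; last by rewrite estep in step0.
apply/andP; split.
  have := @run_conf z t v [:: a; inv_letter a] vU zQ ev zt N_gt1.
  rewrite acts_cons ea /= acts1 (act_inv ea) iota_self // srun_cons.
  rewrite flip_code_letter.
  by case: (step cert (code_letter a) (conf v z t)) step0 => // s' _; rewrite srun1 => ->.
rewrite (entry_mod4 _ _ _ ea) // estep.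
have [z2 z2Q [ez2 [r2 er]]] := zt; rewrite er in estep step0 *.
have N1 : size [:: a] <= N by apply: ltnW.
have yz : bag p (ret z) y by apply: (bag_near ev N1).
case: eqP => [py|/eqP n0]; last case: eqP => [py|/eqP n1]; rewrite /= /valid.
- have zv0 := iso_bagV (iso z) yz.
  have pv0 : p (psi z y) = z.
    apply: (bag_eq zv0); have := iso_level (iso z) zv0.
    by rewrite (iso_Kd (iso z)) // py; lia.
  rewrite -/(conf (psi z y) z2 r2) valid_top_conf //; first by rewrite pv0 ez2 eqxx.
  by apply: (@U_mem z2); rewrite pv0.
- have yU : y \in U by apply: U_mem py.
  rewrite valid_top_conf // py eqxx; apply/allbP => -[|//] _.
  apply: (@below_pair _ _ z z2) => //; first exact: digit_conf1.
  by rewrite digit_conf2 digit_node.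
have ey : behead (p y) = p v.
  apply: close_up; first by apply: (near N1); rewrite acts1.
  by rewrite (bag_level2 yz n0 n1) -ev; case: (p v) (p_neq0 v).
have eb := phi_behead ey.
rewrite valid_top_conf ?Q_mem //; last exact: U_mem eb.
rewrite eb eqxx; apply/allbP => -[|[|//]] _.
- apply: (@below_pair _ _ (p v) z); rewrite ?Q_mem //; first exact: digit_conf1.
  by rewrite digit_conf2 digit_node.
- apply: (@below_pair _ _ z z2) => //; first by rewrite digit_conf2 digit_node.
  by rewrite digit_conf2 digit_nodeS digit_node.
Qed.

Hypothesis po : behead (p o) = [::].

Lemma oU : o \in U. Proof. by apply: (@U_mem [::]); rewrite ret0. Qed.

Lemma conf_o : conf o [::] 0 = index o U.
Proof. by rewrite /conf /node /= !muln0 addn0. Qed.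

Lemma digit_zero i : digit cert 0 i = 0.
Proof. by rewrite /digit div0n mod0n. Qed.

Lemma valid_o : valid cert (index o U) (index o U).
Proof.
rewrite -conf_o /valid valid_top_conf ?oU ?Q_mem0 // po ret0 eqxx.
apply/allbP => i _; apply: (@below_pair _ _ [::] [::]); rewrite ?Q_mem0 //.
  by case: i => [|i]; rewrite ?digit_conf1 // digit_conf2 digit_zero.
by rewrite digit_conf2 digit_zero.
Qed.

Lemma below0_cert : nnth (nnth cert 3) 0 != 0.
Proof.
rewrite cert3 nnth_mkseq ?muln_gt0 // /adj_below div0n mod0n /=.
by rewrite ret0.
Qed.

(** Vertices close to [o] lie on the first or second level. Digit 1, the node [[::]] or [p o], tells
    the levels apart, and digit 0 then determines the vertex. *)
Lemma iota_inj y y' : close (p o) (p y) -> close (p o) (p y') ->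
  iota [::] 0 y = iota [::] 0 y' -> y = y'.
Proof.
have p0 x : (p x == [::]) = false by apply/negbTE/p_neq0.
have index_inj x x' : x \in U -> x' \in U -> index x U = index x' U -> x = x'.
  by move=> xU xU' e; rewrite -(nth_index o xU) e nth_index.
have lev2 x : close (p o) (p x) -> behead (p x) != [::] -> behead (p x) = p o.
  move=> cx n1; apply: close_up => //; have := close_size cx.
  move: po n1 (p_neq0 x) (p_neq0 o).
  by case: (p o) => // c q /= ->; case: (p x) => // d [|e [|]].
move=> cy cy'; rewrite /iota ret0 !p0.
case: eqP => [e1|/eqP/(lev2 _ cy) e1]; case: eqP => [e2|/eqP/(lev2 _ cy') e2].
- move/(congr1 (fun s => digit cert s 0)); rewrite !digit_conf0.
  by apply: index_inj; apply: (@U_mem [::]); rewrite ret0.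
- move/(congr1 (fun s => digit cert s 1)); rewrite !digit_conf1 e2 /node /=.
  by rewrite eq_sym p0.
- move/(congr1 (fun s => digit cert s 1)); rewrite !digit_conf1 e1 /node /=.
  by rewrite eq_sym p0.
- move/(congr1 (fun s => digit cert s 0)); rewrite !digit_conf0 e1 e2.
  move/index_inj => inj; have /inj e : phi (p o) y \in U by apply: U_mem (phi_behead e1).
  have {}e : phi (p o) y = phi (p o) y' by apply: e; apply: U_mem (phi_behead e2).
  have by1 x : behead (p x) = p o -> bag p (p o) x.
    move=> <-; rewrite /bag; case: (p x) (p_neq0 x) => // d q _.
    by exists [:: d].
  by rewrite -(iso_K (iso (p o)) (by1 _ e1)) e (iso_K (iso (p o)) (by1 _ e2)).
Qed.

Lemma run_o (w : word n) : size w <= N -> run cert (code_word w) (index o U) =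
  if acts act w o is Some y then (iota [::] 0 y).+1 else 0.
Proof.
move=> lew; rewrite -conf_o runE /code_word CodeSeq.codeK run_conf //.
- exact: oU.
- by rewrite po ret0.
- by exists [::]; rewrite ?inE //; split; rewrite ?ret0 //; exists 0; rewrite muln0.
Qed.

Lemma runs_differ (u v : word n) : size u <= N -> size v <= N ->
  acts act u o <> acts act v o ->
  run cert (code_word u) (index o U) != run cert (code_word v) (index o U).
Proof.
move=> leu lev nuv; rewrite !run_o //; apply/eqP; move: nuv.
case eu: (acts act u o) => [y|]; case ev: (acts act v o) => [y'|] // ne [e].
by apply: ne; congr Some; apply: iota_inj e; [apply: near eu | apply: near ev].
Qed.

End Certificate.

Lemma tree_partition_separates (P : presentation) (V C : eqType)
    (act : 'I_(ngens P) * bool -> V -> option V) (p : V -> seq C) (G N : nat)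
    (o : V) (u v : word (ngens P)) :
  (forall a x y, act a x = Some y -> act (inv_letter a) y = Some x) ->
  (forall y, p y != [::]) ->
  (forall w x y, size w <= N -> acts act w x = Some y -> close (p x) (p y)) ->
  (forall c y y', bag p c y -> bag p c y' ->
    exists2 w, size w <= G & acts act w y = Some y') ->
  1 < N ->
  (forall l r, (l, r) \in relators P -> [/\ size l <= N, size r <= N &
    forall x, acts act l x = acts act r x]) ->
  behead (p o) = [::] -> size u <= N -> size v <= N ->
  acts act u o <> acts act v o ->
  exists c,
    separates (ngens P) (code_relators P) (code_word u) (code_word v) c.
Proof.
move=> act_inv p_neq0 near conn N1 rels po leu lev nuv.
have [ret [phi [psi [U [ret0 iso U_mem]]]]] := regularization conn.
have U_uniq : uniq (undup U) := undup_uniq U.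
have {}U_mem c y : behead (p y) = ret c -> y \in undup U.
  by rewrite mem_undup => e; apply: U_mem e (p_neq0 y).
exists (cert act p ret phi psi (undup U) o); apply/and5P; split.
- apply/allbP => a lta.
  have lta2 : a./2 < ngens P by lia.
  have -> : a = code_letter (Ordinal lta2, odd a).
    by rewrite /code_letter /= addnC odd_double_half.
  exact: (good_letter_cert (N := N)).
- apply/allbP => i; rewrite size_relators => lti.
  have [-> ->] := lhs_relators lti.
  have [lel ler elr] : [/\ size (nth ([::], [::]) (relators P) i).1 <= N,
      size (nth ([::], [::]) (relators P) i).2 <= N & forall x,
      acts act (nth ([::], [::]) (relators P) i).1 x =
      acts act (nth ([::], [::]) (relators P) i).2 x].
    by apply: rels; rewrite -surjective_pairing mem_nth.
  exact: (respects_cert (N := N)).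
- by rewrite cert4; apply: valid_o.
- exact: below0_cert.
- by rewrite cert4; apply: (runs_differ (N := N)).
Qed.

(** * Tree partitions from rooted trees *)

Section RootedTree.
Variables (T : eqType) (par : T -> T) (dep : T -> nat).
Hypothesis dep_par : forall z, dep (par z) = (dep z).-1.
Hypothesis dep_root : forall z z', dep z = 0 -> dep z' = 0 -> z = z'.

Definition common k z z' :=
  exists i j, [/\ i <= k, j <= k & iter i par z = iter j par z'].

Lemma dep_iter i z : dep (iter i par z) = dep z - i.
Proof. by elim: i => [|i IHi] /=; rewrite ?subn0 // dep_par IHi; lia. Qed.

Lemma common_trans k l x y z : common k x y -> common l y z -> common (k + l) x z.
Proof.
move=> [i [j [lei lej exy]]] [i' [j' [lei' lej' eyz]]].
have [le|/ltnW le] := leqP j i'.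
  exists (i' - j + i), j'; split; try lia.
  by rewrite iterD exy -iterD subnK.
exists i, (j - i' + j'); split; try lia.
by rewrite iterD -eyz -iterD subnK.
Qed.

Lemma common_leq k l x y : k <= l -> common k x y -> common l x y.
Proof.
by move=> lekl [i [j [lei lej e]]]; exists i, j; rewrite !(leq_trans _ lekl).
Qed.

Variable h : nat.
Hypothesis h_gt0 : 0 < h.

(* The ancestors of [z] at depths divisible by [h], deepest first. *)
Definition chain z :=
  mkseq (fun j => iter (dep z %% h + h * j) par z) (dep z %/ h).+1.

(** Climbing at most [h] levels crosses at most one slab boundary. *)
Lemma chain_iter i z : i <= h ->
  chain (iter i par z) = chain z \/ chain (iter i par z) = behead (chain z).
Proof.
(* Climbing past the root has the same effect as climbing to the root. *)
wlog ltiz : i / i <= dep z => [H leih|].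
  have [//|/ltnW lt] := leqP i (dep z); first by move/H; apply.
  have -> : iter i par z = iter (dep z) par z.
    by apply: dep_root; rewrite dep_iter; lia.
  by apply: H => //; apply: leq_trans leih.
move=> leih; set d := dep z in ltiz *.
have ed := divn_eq d h; have ltm := ltn_pmod d h_gt0.
have [leim|ltmi] := leqP i (d %% h).
  have em : d - i = d %/ h * h + (d %% h - i) by lia.
  have lt : d %% h - i < h by lia.
  left; rewrite /chain dep_iter -/d em divnMDl // modnMDl (divn_small lt).
  rewrite (modn_small lt) addn0; apply: eq_map => j.
  by rewrite -iterD; congr (iter _ _ _); lia.
have q0 : 0 < d %/ h by case: (d %/ h) ed => [|//]; lia.
have em : d - i = (d %/ h).-1 * h + (h + d %% h - i).
  by rewrite {1}ed -[in LHS](prednK q0) mulSn; lia.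
have lt : h + d %% h - i < h by lia.
right; rewrite /chain dep_iter -/d em divnMDl // modnMDl (divn_small lt).
rewrite (modn_small lt) addn0 prednK // /mkseq [in RHS]/= -[1]addn0 iotaDl -map_comp.
apply: eq_map => j /=; rewrite -iterD; congr (iter _ _ _).
rewrite mulnDr muln1; lia.
Qed.

Lemma common_close z z' : common h z z' -> close (chain z) (chain z').
Proof.
have up i y : i <= h ->
    exists2 l, chain y = l ++ chain (iter i par y) & size l <= 1.
  move=> lei; have [->|->] := chain_iter y lei; first by exists [::].
  exists (take 1 (chain y)); first by rewrite -drop1 cat_take_drop.
  by rewrite size_take_min geq_minl.
move=> [i [j [lei lej e]]]; have [l el lel] := up i z lei.
have [l' el' lel'] := up j z' lej.
by exists (chain (iter i par z)), l, l'; split=> //; rewrite e.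
Qed.

(** Fewer than [h] steps reach the first entry of the chain, and each of the at most two entries of
    [l] costs [h] more. *)
Lemma chain_bag z l c : chain z = l ++ c -> size l <= 2 ->
  exists2 i, i <= 3 * h &
    if c is t :: _ then iter i par z = t else dep (iter i par z) = 0.
Proof.
move=> ez lel; have ltm := ltn_pmod (dep z) h_gt0.
have sz : size (chain z) = (dep z %/ h).+1 by rewrite size_mkseq.
case: c ez => [|t c] ez; rewrite ez size_cat /= in sz.
  exists (dep z); last by rewrite dep_iter subnn.
  have := divn_eq (dep z) h; have : dep z %/ h <= 1 by lia.
  by case: (dep z %/ h) => [|[|//]] _; lia.
exists (dep z %% h + h * size l).
  have : h * size l <= h * 2 by rewrite leq_mul2l lel orbT.
  by lia.
have -> : t = nth z (chain z) (size l) by rewrite ez nth_cat ltnn subnn.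
by rewrite nth_mkseq //; lia.
Qed.

Lemma chain_common z z' l l' c : chain z = l ++ c -> chain z' = l' ++ c ->
  size l <= 2 -> size l' <= 2 -> common (3 * h) z z'.
Proof.
move=> ez ez' lel lel'; have [i lei ei] := chain_bag ez lel.
have [j lej ej] := chain_bag ez' lel'; exists i, j; split=> //.
by case: c {ez ez'} ei ej => [|t c] => [ei ej|-> ->] //; apply: dep_root.
Qed.

End RootedTree.

(** Words of length at most [N] have endpoints with a common ancestor within [K * N < h] levels, so
    their nodes are close. Vertices of one bag have one within [3 * h] levels, and properness of [f]
    then bounds the words joining them. *)
Lemma coarse_separates (P : presentation) (V T : eqType)
    (act : 'I_(ngens P) * bool -> V -> option V)
    (par : T -> T) (dep : T -> nat) (f : V -> T) (K : nat)
    (o : V) (u v : word (ngens P)) :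
  (forall z, dep (par z) = (dep z).-1) ->
  (forall z z', dep z = 0 -> dep z' = 0 -> z = z') ->
  (forall a x y, act a x = Some y -> act (inv_letter a) y = Some x) ->
  (forall a x y, act a x = Some y -> common par K (f x) (f y)) ->
  (forall m, exists g, forall x y, common par m (f x) (f y) ->
    exists2 w, size w <= g & acts act w x = Some y) ->
  dep (f o) = 0 ->
  (forall l r, (l, r) \in relators P -> forall x, acts act l x = acts act r x) ->
  acts act u o <> acts act v o ->
  exists c,
    separates (ngens P) (code_relators P) (code_word u) (code_word v) c.
Proof.
move=> dep_par dep_root act_inv lip prop depo rels nuv.
pose N := 2 + size u + size v +
  \sum_(r <- relators P) (size r.1 + size r.2).
pose h := (K * N).+1.
have [G GP] := prop (3 * h).
apply: (@tree_partition_separates _ _ _ act (fun x => chain par dep h (f x)) G N o)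
  => //; try by rewrite /N; lia.
- move=> w x y lew ew; apply: common_close => //.
  apply: (@common_leq _ _ (K * size w)).
    by apply: leqW; rewrite leq_mul2l lew orbT.
  elim/last_ind: w y {lew} ew => [|w a IHw] y.
    by case=> ->; exists 0, 0.
  rewrite acts_rcons; case ew: (acts act w x) => [x'|//] /= ea.
  rewrite size_rcons mulnSr; apply: common_trans (IHw _ ew) (lip _ _ _ ea).
- move=> c y y' [l ey lel] [l' ey' lel']; apply: GP.
  exact: (chain_common dep_par dep_root (ltn0Sn _) ey ey').
- move=> l r lr; have : size l + size r <= N.
    rewrite /N (big_rem _ lr) /=; lia.
  by split; [lia | lia | apply: rels].
- by rewrite /chain depo div0n.
Qed.

(** * Trees as graphs *)

Section PathDistance.
Variables (V : eqType) (e : rel V).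

Lemma path_dist_le x q : path e x q -> path_dist e x (last x q) <= size q.
Proof.
move=> px; rewrite /path_dist; case: pselect => [ex|//].
by case: ex_minnP => m _; apply; apply/asboolP; exists q.
Qed.

Lemma path_dist_path x y : reachable e x y ->
  exists q, [/\ path e x q, last x q = y & size q = path_dist e x y].
Proof.
move=> [q pq lq]; rewrite /path_dist; case: pselect => [ex|nex]; last first.
  by case: nex; exists (size q); apply/asboolP; exists q.
by case: ex_minnP => m /asboolP.
Qed.

Lemma reachable_trans y x z : reachable e x y -> reachable e y z ->
  reachable e x z.
Proof.
by move=> [q pq <-] [q' pq' <-]; exists (q ++ q'); rewrite ?cat_path ?pq ?last_cat.
Qed.

Lemma reachable_sym : symmetric e -> forall x y, reachable e x y -> reachable e y x.
Proof.
move=> es x y [q pq <-]; exists (rev (belast x q)).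
  by rewrite rev_path (eq_path (e' := e)) // => a b; rewrite es.
by case: q pq => //= a q _; rewrite rev_cons last_rcons.
Qed.

End PathDistance.

Section TreeGraph.
Variables (T : eqType) (t : rel T) (r : T).
Hypothesis tree : is_tree t.

Let t_sym : symmetric t. Proof. by case: tree. Qed.
Let t_irr : irreflexive t. Proof. by case: tree. Qed.
Let t_conn x y : reachable t x y. Proof. by case: tree. Qed.
Let t_cycle c : ucycle t c -> size c <= 2. Proof. by case: tree => _ _ _; apply. Qed.

Local Notation dep := (path_dist t r).

Lemma dep_root z : dep z = 0 -> z = r.
Proof.
move=> dz; have [q [_ lq sq]] := path_dist_path (t_conn r z).
by move: sq lq; rewrite dz => /size0nil->.
Qed.

Lemma dep_r : dep r = 0.
Proof. by apply/eqP; rewrite -leqn0; apply: (@path_dist_le _ t r [::]). Qed.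

Lemma dep_adj z z' : t z z' -> dep z' <= (dep z).+1.
Proof.
move=> tz; have [q [pq lq <-]] := path_dist_path (t_conn r z).
have := @path_dist_le _ t r (rcons q z').
by rewrite last_rcons size_rcons rcons_path pq lq tz; apply.
Qed.

Lemma parent_exists : exists par : T -> T,
  forall z, dep (par z) = (dep z).-1 /\ (z = r \/ t z (par z)).
Proof.
suff H z : exists y, dep y = (dep z).-1 /\ (z = r \/ t z y).
  by have [par parP] := choice H; exists par.
have [q [pq lq sq]] := path_dist_path (t_conn r z).
case/lastP: q pq lq sq => [|q y].
  by move=> _ /= <- _; exists r; rewrite dep_r; split=> //; left.
rewrite rcons_path last_rcons size_rcons => /andP[pq ty] ey sq; subst y.
exists (last r q); rewrite t_sym ty; split; last by right.
apply/eqP; rewrite -sq eqn_leq path_dist_le //=.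
by have := dep_adj ty; rewrite -sq.
Qed.

Variable par : T -> T.
Hypothesis parP : forall z, dep (par z) = (dep z).-1 /\ (z = r \/ t z (par z)).

(** Passing to parents strictly lowers the depth, which starts no greater than that of [z], so [z]
    is never met. *)
Lemma avoid z x : z != r -> x != z -> dep x <= dep z ->
  reachable (fun a b => [&& t a b, a != z & b != z]) r x.
Proof.
move=> zr; have [m] := ubnP (dep x); elim: m x => // m IHm x ltm xz lex.
have [dx|dx] := eqVneq (dep x) 0; first by rewrite (dep_root dx); exists [::].
have [dp [xr|tx]] := parP x; first by rewrite xr dep_r in dx.
have pz : par x != z by apply/eqP => e; move: dp dx; rewrite e; lia.
apply: (reachable_trans (IHm (par x) _ pz _)); try lia.
by exists [:: x]; rewrite //= t_sym tx pz xz.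
Qed.

(* If [z'] is another neighbour of [z] than its parent, then both are joined   *)
(* to the root away from [z], which closes a cycle through [z].                *)
Lemma tree_adj z z' : t z z' -> dep z' <= dep z -> z' = par z.
Proof.
move=> tz le; have zz' : z' != z.
  by apply/eqP => e; rewrite e t_irr in tz.
have zr : z != r.
  apply/eqP => e; move: le; rewrite e dep_r leqn0 => /eqP/dep_root e'.
  by rewrite e' e eqxx in zz'.
have dz : dep z != 0 by apply: contra zr => /eqP/dep_root->.
have [dp [/eqP|tp]] := parP z; first by rewrite (negPf zr).
apply/eqP/negPn/negP => nz'.
have pz : par z != z by apply/eqP => e; move: dp dz; rewrite e; lia.
set e := fun a b => [&& t a b, a != z & b != z].
have e_sym : symmetric e.
  by move=> a b; rewrite /e t_sym; congr (_ && _); rewrite andbC.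
have [q pq lq] : reachable e (par z) z'.
  apply: (@reachable_trans _ _ r); last exact: avoid.
  by apply: reachable_sym => //; apply: avoid => //; lia.
case: (shortenP pq) lq => q' pq' uq' _ lq'.
have zq : z \notin q'.
  elim: q' (par z) pq' {uq' lq'} => //= a q' IHq x /andP[/and3P[_ _ az] pq'].
  by rewrite inE negb_or eq_sym az (IHq _ pq').
move: uq'; rewrite cons_uniq => /andP[pq0 uq'].
have := @t_cycle (z :: par z :: q'); rewrite /ucycle /=.
rewrite rcons_path tp lq' t_sym tz inE eq_sym negb_or pz zq pq0 uq' /= !andbT.
have -> : path t (par z) q' by apply: sub_path pq' => a b /and3P[].
move=> /(_ isT); case: q' lq' {pq' uq' pq0 zq} => //= e'.
by rewrite e' eqxx in nz'.
Qed.

Lemma adj_common z z' : t z z' -> common par 1 z z'.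
Proof.
move=> tz; have [le|/ltnW le] := leqP (dep z') (dep z).
  by exists 1, 0; rewrite (tree_adj tz le).
by exists 0, 1; rewrite (tree_adj (etrans (t_sym _ _) tz) le).
Qed.

Lemma dist_common z z' : common par (path_dist t z z') z z'.
Proof.
have [q [pq lq <-]] := path_dist_path (t_conn z z').
elim: q z pq lq => [|y q IHq] z /=; first by move=> _ ->; exists 0, 0.
case/andP=> tz pq lq; rewrite -add1n.
exact: common_trans (adj_common tz) (IHq _ pq lq).
Qed.

Lemma iter_par_path i z : exists q, [/\ path t z q, last z q = iter i par z & size q <= i].
Proof.
elim: i => [|i [q [pq lq sq]]]; first by exists [::].
have [_ [e|tp]] := parP (iter i par z); last first.
  by exists (rcons q (iter i.+1 par z)); rewrite rcons_path pq lq last_rcons size_rcons.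
exists q; split=> //=; last exact: leqW.
rewrite lq e; apply/esym/dep_root.
by have [-> _] := parP r; rewrite dep_r.
Qed.

Lemma common_dist k z z' : common par k z z' -> path_dist t z z' <= k + k.
Proof.
move=> [i [j [lei lej e]]]; have [q [pq lq sq]] := iter_par_path i z.
have [q' [pq' lq' sq']] := iter_par_path j z'.
have := @path_dist_le _ t z (q ++ rev (belast z' q')).
rewrite cat_path pq last_cat lq e -lq' rev_path.
rewrite (eq_path (e' := t)) => [|a b]; last by rewrite t_sym.
have -> : last (last z' q') (rev (belast z' q')) = z'.
  by case: (q') => //= a s; rewrite rev_cons last_rcons.
move/(_ pq') => le; apply: leq_trans le _.
by rewrite size_cat size_rev size_belast; apply: leq_add; [apply: leq_trans lei | apply: leq_trans lej].
Qed.

End TreeGraph.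

(** * Schuetzenberger graphs *)

Import Order.TTheory GRing.Theory Num.Theory.

Lemma real_bound (x : Rdefinitions.R) :
  exists n : nat, forall m : nat, (m%:R <= x)%R -> m <= n.
Proof.
exists (Num.bound `|x|%R) => m lem; rewrite -(@ler_nat Rdefinitions.R).
apply: le_trans lem _; apply: le_trans (ler_norm x) _.
exact/ltW/archi_boundP.
Qed.

Section Component.
Local Open Scope group_scope.
Variable P : presentation.
Local Notation M := (Inv P).
Variables (X : seq M) (s : M).
Hypothesis genX : generates X.

Lemma inv_word_cat n (u v : word n) : inv_word (u ++ v) = inv_word v ++ inv_word u.
Proof. by rewrite /inv_word map_cat rev_cat. Qed.

(** Cancelling by means of [m] gives [x w w^-1 x^-1 x = x]; the idempotents [w w^-1] and [x^-1 x]
    commute, and [x x^-1 x = x]. *)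
Lemma mul_inv_word (x : M) (w : word (ngens P)) m : x = x * cls w * m ->
  x * cls w * cls (inv_word w) = x.
Proof.
move=> ex; pose xw := repr x; have exw : x = cls xw by apply: clsE.
have [g _] := cls_inverse (xw ++ w); rewrite clsM -exw mulgA in g.
have gx : x * cls w * cls (inv_word (xw ++ w)) * x = x.
  by rewrite {2}ex !mulgA g -ex.
rewrite inv_word_cat clsM in gx; have [k _] := cls_inverse xw; rewrite -exw in k.
have c := cls_commute w (inv_word xw); rewrite inv_wordK -exw in c.
rewrite -[RHS]gx !mulgA -(mulgA x) -(mulgA _ _ x) -(mulgA x (_ * _)) c.
by rewrite !mulgA k.
Qed.

Lemma cayley_reach x y : reachable (cayley X) x y <-> exists m, y = x * m.
Proof.
split=> [[q]|[m ->]].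
  elim: q x => [|z q IHq] x /=; first by move=> _ <-; exists 1; rewrite mulg1.
  case/andP=> /asboolP[b _ ->] pq lq; have [m ->] := IHq _ pq lq.
  by exists (b * m); rewrite mulgA.
have [l + ->] := genX m; elim: l x => [|b l IHl] x /=.
  by rewrite big_nil mulg1; exists [::].
case/andP=> bX lX; rewrite big_cons mulgA.
have [q pq lq] := IHl (x * b) lX; exists (x * b :: q) => //=.
by rewrite pq andbT; apply/asboolP; exists b.
Qed.

Local Notation V := (component (cayley X) s).

(** A walk that leaves a strong component never returns. Hence a word acts letter by letter exactly
    when its total product stays inside ([cactsE]). *)
Lemma component_mid (x : V) m m' :
  strongly_connected (cayley X) s (val x * m * m') ->
  strongly_connected (cayley X) s (val x * m).
Proof.
have /asboolP[sx _] := valP x => /asboolP[_ /cayley_reach[k ek]].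
apply/asboolP; split.
  by apply: reachable_trans sx _; apply/cayley_reach; exists m.
by apply/cayley_reach; exists (m' * k); rewrite mulgA.
Qed.

Definition cact (a : 'I_(ngens P) * bool) (x : V) : option V :=
  insub (val x * cls [:: a]).

Lemma cactsE w x : acts cact w x = insub (val x * cls w).
Proof.
elim: w x => [|a w IHw] x; first by rewrite mulg1 valK.
rewrite acts_cons -[cact a x]/(insub _) -[in RHS]cat1s clsM mulgA.
case: insubP => [y _ ey|nc] /=; first by rewrite IHw ey.
by rewrite insubN //; apply: contra nc; apply: component_mid.
Qed.

Lemma cact_inv a x y : cact a x = Some y -> cact (inv_letter a) y = Some x.
Proof.
rewrite /cact; case: insubP => // y' _ ey [eyy]; subst y'; rewrite ey.
suff -> : val x * cls [:: a] * cls [:: inv_letter a] = val x by rewrite valK.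
have /asboolP[sx _] := valP x; have /asboolP[_ ys] := valP y.
have /cayley_reach[m ex] := reachable_trans ys sx.
by rewrite ey in ex; have := mul_inv_word ex.
Qed.

(** The quasi-isometry may refer to any finite generating set; this compares its path metric with
    word length in the letters of the presentation. *)
Lemma in_sym_word : exists L, forall b, in_sym X b ->
  exists2 w, cls w = b & size w <= L.
Proof.
exists (\sum_(y <- X) size (repr y)) => b; have le y : y \in X ->
    size (repr y) <= \sum_(z <- X) size (repr z).
  by move=> yX; rewrite (big_rem y) //= leq_addr.
case/orP=> [bX|/asboolP[y yX yb]].
  by exists (repr b); rewrite -?clsE // le.
exists (inv_word (repr y)); last by rewrite size_rev size_map le.
have [z [_ uz]] := Inv_inverse_monoid y; rewrite -(uz _ yb).
by apply/esym/uz; rewrite [X in is_inverse X]clsE; apply: cls_inverse.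
Qed.

Lemma component_path l (x y : V) : all (in_sym X) l ->
  val y = val x * \prod_(b <- l) b ->
  exists q, [/\ path (@component_rel _ (cayley X) s) x q, last x q = y
    & size q = size l].
Proof.
elim: l x => [|b l IHl] x /=.
  by rewrite big_nil mulg1 => _ /val_inj->; exists [::].
case/andP=> bX lX; rewrite big_cons mulgA => ey.
have sxb : strongly_connected (cayley X) s (val x * b).
  by apply: (component_mid (m' := \prod_(b <- l) b)); rewrite -ey; apply: valP.
pose xb : V := exist _ (val x * b) sxb.
have [q [pq lq sq]] := IHl xb lX ey.
exists (xb :: q) => /=; rewrite pq lq sq andbT; split=> //.
by apply/asboolP; exists b.
Qed.

Lemma component_connected (x y : V) :
  reachable (@component_rel _ (cayley X) s) x y.
Proof.
have /asboolP[_ xs] := valP x; have /asboolP[sy _] := valP y.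
have /cayley_reach[m ey] := reachable_trans xs sy.
have [l lX em] := genX m; rewrite em in ey.
by have [q [pq lq _]] := component_path lX ey; exists q.
Qed.

Lemma path_word L : (forall b, in_sym X b -> exists2 w, cls w = b & size w <= L) ->
  forall q (x : V), path (@component_rel _ (cayley X) s) x q ->
  exists2 w, size w <= L * size q & val (last x q) = val x * cls w.
Proof.
move=> LP; elim=> [|y q IHq] x /=; first by exists [::]; rewrite // mulg1.
case/andP=> /asboolP[b bX ey] /IHq[w lew ->]; have [wb ewb leb] := LP b bX.
exists (wb ++ w); first by rewrite size_cat mulnS leq_add.
by rewrite clsM ewb mulgA ey.
Qed.

(** Rooting the tree at the image of [o], the upper bound of the quasi-isometry limits how far a
    letter moves in the tree, and the lower bound limits the words joining vertices whose images
    have a near common ancestor. *)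
Lemma component_separates (o : V) (u v : word (ngens P)) :
  quasi_isometric_to_tree (@component_rel _ (cayley X) s) ->
  acts cact u o <> acts cact v o ->
  exists c,
    separates (ngens P) (code_relators P) (code_word u) (code_word v) c.
Proof.
move=> [T [t [tree [f [K [C [K1 C0 qi _]]]]]]] nuv.
set e := @component_rel _ (cayley X) s in qi.
have [par parP] := parent_exists (f o) tree.
have K0 : (0 < K)%R by apply: lt_le_trans ltr01 K1.
have [K' lip] : exists K', forall a x y, cact a x = Some y ->
    common par K' (f x) (f y).
  have /fin_all_exists[k kP] a : exists k, forall x y, cact a x = Some y ->
      path_dist t (f x) (f y) <= k.
    have [l lX el] := genX (cls [:: a]); have [k kP] := real_bound (K * (size l)%:R + C)%R.
    exists k => x y; rewrite /cact; case: insubP => // y' _ ey [eyy]; subst y'.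
    rewrite el in ey; have [q [pq lq sq]] := component_path lX ey.
    apply: kP; have /andP[_ le] := qi x y; apply: le_trans le _.
    rewrite lerD2r ler_pM2l // ler_nat -sq -lq; exact: path_dist_le.
  exists (\max_a k a) => a x y ea; apply: common_leq (dist_common tree parP _ _).
  by apply: leq_trans (kP _ _ _ ea) _; apply: (leq_bigmax a).
apply: (@coarse_separates P V T cact par (path_dist t (f o)) f K' o) => //.
- by move=> z; case: (parP z).
- by move=> z z' /(dep_root tree)-> /(dep_root tree)->.
- exact: cact_inv.
- move=> m; have [L LP] := in_sym_word.
  have [d dP] := real_bound (K * ((m + m)%:R + C))%R.
  exists (L * d)%N => x y /(common_dist tree parP) le.
  have [q [pq lq sq]] := path_dist_path (component_connected x y).
  have [w lew ew] := path_word LP pq; rewrite lq in ew.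
  exists w; last by rewrite cactsE -ew valK.
  apply: leq_trans lew _; rewrite leq_mul2l sq; apply/orP; right; apply: dP.
  have /andP[+ _] := qi x y; rewrite lerBlDr => le'.
  rewrite -ler_pdivrMl //; apply: le_trans le' _.
  by rewrite lerD2r ler_nat.
- exact: dep_r.
- move=> l r lr x; rewrite !cactsE; congr (insub (_ * _)).
  exact/clsP/tau_relator.
Qed.

End Component.

(** * Separation in tree-like inverse monoids, and the algorithm *)

Section TreeLike.
Local Open Scope group_scope.

(** If [u] and [v] act alike on the components of both, evaluation at [u u^-1] and [v v^-1] gives
    [u u^-1 v = u] and [v v^-1 u = v]: each is below the other in the natural order, so they are
    equal. *)
Lemma tree_like_separates (P : presentation) (u v : word (ngens P)) :
  tree_like (Inv P) -> cls u <> cls v ->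
  exists c,
    separates (ngens P) (code_relators P) (code_word u) (code_word v) c.
Proof.
move=> [X [genX qi]] nuv; apply: contrapT => nsep; apply: nuv.
have key w : exists o : component (cayley X) (cls w : Inv P),
    val o = cls w * cls (inv_word w).
  suff co : strongly_connected (cayley X) (cls w : Inv P) (cls w * cls (inv_word w)).
    by exists (exist _ (cls w * cls (inv_word w)) co).
  apply/asboolP; split; apply/(cayley_reach genX).
    by exists (cls (inv_word w)).
  by exists (cls w); have [-> _] := cls_inverse w.
have fix1 w w' : (forall o : component (cayley X) (cls w : Inv P),
      acts (@cact P X (cls w)) w o = acts (@cact P X (cls w)) w' o) ->
    cls w * cls (inv_word w) * cls w' = cls w :> Inv P.
  have [o eo] := key w => /(_ o); rewrite !cactsE // eo.
  have [-> _] := cls_inverse w; case: insubP => [y _ ey|].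
    case: insubP => // y' _ ey' [eyy].
    exact: etrans (esym ey') (etrans (congr1 val (esym eyy)) ey).
  by case/asboolP; split; exists [::].
have eu : cls u * cls (inv_word u) * cls v = cls u :> Inv P.
  apply: fix1 => o; apply: contrapT => ne; apply: nsep.
  by have := component_separates genX (qi _) ne.
have ev : cls v * cls (inv_word v) * cls u = cls v :> Inv P.
  apply: fix1 => o; apply: contrapT => ne; apply: nsep.
  by have := component_separates genX (qi _) (fun e => ne (esym e)).
have c : commute _ _ := cls_commute u v.
have [k _] := cls_inverse u.
transitivity (cls u * cls (inv_word u) * (cls v * cls (inv_word v) * cls u)).
  by rewrite ev eu.
by rewrite mulgA c -mulgA k ev.
Qed.

End TreeLike.

Theorem theorem4p15 :
  exists f : recfun 4,
  forall P : presentation, tree_like (Inv P) ->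
  forall u v : word (ngens P),
    (cls u = cls v -> computes f (code_input u v) 1) /\
    (cls u <> cls v -> computes f (code_input u v) 0).
Proof.
(* Variable 0 is the witness sought; variables 1 to 4 are the input. *)
pose derived (r : nat -> nat) := derivation (r 2) (r 3) (r 4) (r 0).
pose separated (r : nat -> nat) := separates (r 1) (r 2) (r 3) (r 4) (r 0).
have req : recursiveb derived by apply: recursive_derivation; apply: recursive_var.
have rneq : recursiveb separated by apply: recursive_separates; apply: recursive_var.
have [f fP] := recursive_search 4 (recursive_or req rneq) req.
exists f => P tl u v; pose r := nth 0 (code_input u v).
have sound c : derived (scons c r) -> cls u = cls v.
  by move/derivation_sound; rewrite !code_wordK => /clsP.
have nsound c : separated (scons c r) -> cls u <> cls v.
  by move/separates_sound => ntau /clsP.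
have complete : exists c, derived (scons c r) || separated (scons c r).
  have [e|ne] := pselect (cls u = cls v).
    have [d dP] := derivation_complete ((clsP u v).1 e).
    by exists d; apply/orP; left.
  by have [d dP] := tree_like_separates tl ne; exists d; apply/orP; right.
have [c [ok]] := fP _ complete; rewrite -/r.
(* The output is the truth value of [derived] at the witness found; if it is false, the witness is a
   separating certificate. *)
case eqc: (derived (scons c r)) => comp; split=> //; first by move/(_ (sound c eqc)).
by move: ok; rewrite -/r eqc => /nsound ne /ne.
Qed.
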